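(* If a configuration $C=p_r\dots p_s$ of g-2PATH is of Type I, then $\mathrm{mft}_{\text{g-2PATH}}(C)=-r+s+\max\{-r,s\}$.
   Context: Positions are elements of $\mathbb{Z}^2$; with $\epsilon_0=(1,0),\epsilon_1=(0,1),\epsilon_2=(-1,0),\epsilon_3=(0,-1)$, positions $p,p'$ are adjacent if $p'-p$ is some $\epsilon_i$. A configuration of g-2PATH is a sequence $C=p_r\dots p_s$ ($r\le0\le s$) of positions with $p_0=(0,0)$ (the general), consecutive positions adjacent, all positions distinct, and $p_l,p_m$ not adjacent whenever $|l-m|\ge2$. For $p\in C$, $\mathrm{bc}_C(p)=(b_0,\dots,b_3)$ with $b_i=1$ iff $p+\epsilon_i\in C$. Firing squad model (boundary-sensitive): a finite automaton $A$ has a finite state set with quiescent state $\mathrm{Q}$, general states $\mathrm{G}_0,\dots,\mathrm{G}_{m-1}$, firing states $\mathcal F\not\ni\mathrm{Q}$, a map $\tau:\{0,1\}^4\to\{0,\dots,m-1\}$ and a transition function from the current state and the four neighbour states ($\#$ where no node), with $\mathrm{Q}$ stable when all inputs are in $\{\mathrm{Q},\#\}$. On $C$, at time $0$ node $(0,0)$ is in $\mathrm{G}_{\tau(\mathrm{bc}_C((0,0)))}$, others in $\mathrm{Q}$, synchronous updates. $A$ is a solution of g-2PATH if for every configuration $C$ there is $t_C$ with no node in $\mathcal F$ before $t_C$ and all nodes in $\mathcal F$ at $t_C=:\mathrm{ft}(C,A)$. $\mathrm{mft}_{\text{g-2PATH}}(C)=\min_A\mathrm{ft}(C,A)$ over solutions.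 For $r\le i\le0\le j\le s$, $W(i,j)$ is the set of pairs $(x_0,x_1)$ of finite, possibly empty, sequences of positions such that $x_0p_i\dots p_jx_1$ is a configuration $C'$ of g-2PATH (general at $p_0$) with $\mathrm{bc}_{C'}(p_l)=\mathrm{bc}_C(p_l)$ for $i\le l\le j$; $f(i,j)=\sup\{|x_0|:(x_0,x_1)\in W(i,j)\}$, $g(i,j)=\sup\{|x_1|:(x_0,x_1)\in W(i,j)\}$ (possibly $\infty$). The left hand of $C$ is free if $r=0$ or ($r<0$ and $f(r+1,s)=\infty$), and closed otherwise; the right hand is free if $s=0$ or ($s>0$ and $g(r,s-1)=\infty$), and closed otherwise. $C$ is of Type I if both hands are free. *)

(* Defs.v *)
From HB Require Import structures.
From mathcomp Require Import all_boot all_order all_algebra.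
Set Implicit Arguments. Unset Strict Implicit. Unset Printing Implicit Defensive.
Import Order.TTheory GRing.Theory Num.Theory.
Local Open Scope ring_scope.

Definition pos := (int * int)%type.
Definition origin : pos := (0, 0).
Definition padd (p q : pos) : pos := (p.1 + q.1, p.2 + q.2).

Definition eps (i : 'I_4) : pos :=
  match val i with
  | 0%N => (1, 0)
  | 1%N => (0, 1)
  | 2%N => (-1, 0)
  | _ => (0, -1)
  end.

Definition adjacent (p q : pos) : bool := [exists i : 'I_4, q == padd p (eps i)].

(** A configuration C = p_r ... p_s is represented by the list
    l = [p_r; ...; p_s] together with k = -r, the list index of p_0.
    So p_i = nth origin l (k + i), and s = size l - 1 - k. *)
Definition is_config (l : seq pos) (k : nat) : Prop :=
  [/\ (k < size l)%N,
      nth origin l k = origin,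
      (forall i, (i.+1 < size l)%N -> adjacent (nth origin l i) (nth origin l i.+1)),
      uniq l &
      (forall i j, (j < size l)%N -> (i.+2 <= j)%N ->
                   ~~ adjacent (nth origin l i) (nth origin l j))].

Definition bc (l : seq pos) (p : pos) : {ffun 'I_4 -> bool} :=
  [ffun i => padd p (eps i) \in l].

(** Boundary-sensitive firing squad automata.  Neighbour inputs are
    [option state], with [None] playing the role of #. *)
Record automaton := Automaton {
  state : finType;
  qstate : state;
  ngen : nat;
  gen : 'I_ngen -> state;
  firing : pred state;
  tau : {ffun 'I_4 -> bool} -> 'I_ngen;
  delta : state -> {ffun 'I_4 -> option state} -> state;
  qstate_not_firing : ~~ firing qstate;
  qstate_stable : forall nb : {ffun 'I_4 -> option state},
      (forall i, nb i = None \/ nb i = Some qstate) -> delta qstate nb = qstate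
}.

Fixpoint run (A : automaton) (l : seq pos) (t : nat) (p : pos) : state A :=
  match t with
  | 0%N => if p == origin then @gen A (@tau A (bc l p)) else @qstate A
  | t'.+1 =>
      @delta A (run A l t' p)
        [ffun i => if padd p (eps i) \in l
                   then Some (run A l t' (padd p (eps i))) else None]
  end.

Definition fires_at (A : automaton) (l : seq pos) (t : nat) : Prop :=
  (forall t', (t' < t)%N -> forall p, p \in l -> ~~ @firing A (run A l t' p)) /\
  (forall p, p \in l -> @firing A (run A l t p)).

Definition solution (A : automaton) : Prop :=
  forall l k, is_config l k -> exists t, fires_at A l t.

Definition is_mft (l : seq pos) (n : nat) : Prop :=
  (exists A, solution A /\ fires_at A l n) /\
  (forall A, solution A -> forall t, fires_at A l t -> (n <= t)%N).

(** W(i,j), with i,j given as list indices a = k+i, b = k+j (a <= k <= b). *)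
Definition in_W (l : seq pos) (k a b : nat) (x0 x1 : seq pos) : Prop :=
  let C' := x0 ++ drop a (take b.+1 l) ++ x1 in
  is_config C' (size x0 + (k - a)) /\
  (forall j, (a <= j)%N -> (j <= b)%N ->
     bc C' (nth origin l j) = bc l (nth origin l j)).

Definition f_infinite (l : seq pos) (k a b : nat) : Prop :=
  forall n : nat, exists x0 x1, in_W l k a b x0 x1 /\ (n <= size x0)%N.
Definition g_infinite (l : seq pos) (k a b : nat) : Prop :=
  forall n : nat, exists x0 x1, in_W l k a b x0 x1 /\ (n <= size x1)%N.

(** r = -k, s = size l - 1 - k. *)
Definition left_free (l : seq pos) (k : nat) : Prop :=
  k = 0%N \/ ((0 < k)%N /\ f_infinite l k 1 (size l).-1).
Definition right_free (l : seq pos) (k : nat) : Prop :=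
  k = (size l).-1 \/ ((k < (size l).-1)%N /\ g_infinite l k 0 (size l).-2).

Definition type_I (l : seq pos) (k : nat) : Prop := left_free l k /\ right_free l k.

(* Main.v *)
Require Import Defs.
From HB Require Import structures.
From mathcomp Require Import all_boot all_order all_algebra zify.
Set Implicit Arguments. Unset Strict Implicit. Unset Printing Implicit Defensive.

(** Lower bound: the far end of the right arm hears of the left end only at time
    [2k + s], via the general.  If the left arm can be prolonged arbitrarily, then
    before that time the far right end behaves as in a configuration whose left end
    is still quiescent, so it cannot fire; the right arm is symmetric.

    Upper bound: the automaton may depend on the configuration.  Run in parallel any
    solution, here a Minsky-style divide and conquer of arbitrary speed, and a timer
    with counters bounded in terms of [k] and [s].  The timer broadcasts the lengths
    of both arms, which all nodes know by time [k + s + max k s] if the arms have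
    lengths [k] and [s], and it fires at that time exactly on these configurations.
    By the lower bound the slow solution does not fire earlier on the given one. *)

(** * Paths *)

(** The left end cannot act before it wakes up at time k, and its news needs k + s further steps to
    the right end. This is also when the timer has carried the left length to the right end, so the
    larger of the two such times, one per hand, is both the bound and the firing time. What shapes
    the automata is the lack of a common orientation: a path turns, so a node sees up to two of its
    four ports occupied and cannot tell which one leads left. Signals carry ports, segments are read
    in either order, and the timer compares an unordered pair of lengths. It therefore also acts on
    configurations with the arms exchanged, which is harmless: each of the two automata fires all
    nodes at once, so their product fires at the earlier time and remains a solution. From the slow
    solution only existence is needed, so its running time is never computed. *)

Definition turn (e : 'I_4) : 'I_4 := Ordinal (ltn_pmod (e + 2) (isT : 0 < 4)).

Lemma turnK : involutive turn.
Proof. by case=> [[|[|[|[|?]]]] ?] //; apply: val_inj. Qed.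

(** [eps] lists the unit steps in rotational order, so adding 2 modulo 4 reverses a direction. *)
Lemma padd_turn p e : padd (padd p (eps e)) (eps (turn e)) = p.
Proof.
case: p => x y; case: e => [[|[|[|[|?]]]] ?] //; rewrite /padd /eps /=; congr pair; lia.
Qed.

Lemma padd_eps_inj p e e' : padd p (eps e) = padd p (eps e') -> e = e'.
Proof.
case: p => x y; rewrite /padd /eps => -[].
case: e => [[|[|[|[|?]]]] ?] //; case: e' => [[|[|[|[|?]]]] ?] //=;
  (try by move=> *; apply: val_inj); by move=> ? ?; exfalso; lia.
Qed.

Lemma padd_eps_neq p e : padd p (eps e) != p.
Proof.
apply/eqP; case: p => x y; rewrite /padd /eps => -[].
case: e => [[|[|[|[|?]]]] ?] //=; lia.
Qed.

Lemma adjacentP p q : reflect (exists e, q = padd p (eps e)) (adjacent p q).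
Proof. by apply: (iffP existsP) => -[e E]; exists e; apply/eqP. Qed.

Lemma adjacent_sym p q : adjacent p q = adjacent q p.
Proof.
by apply/adjacentP/adjacentP => -[e ->]; exists (turn e); rewrite padd_turn.
Qed.

(** Grid adjacency transported to list indices, so that runs can be followed by index arithmetic. *)
Definition nbr (l : seq pos) (i : nat) (e : 'I_4) : option nat :=
  let q := padd (nth origin l i) (eps e) in
  if q \in l then Some (index q l) else None.

Lemma nbr_padd l i e j : nbr l i e = Some j ->
  j < size l /\ padd (nth origin l i) (eps e) = nth origin l j.
Proof.
by rewrite /nbr; case: ifP => // lq [<-]; rewrite index_mem lq nth_index.
Qed.

Lemma nbr_mem l i e : isSome (nbr l i e) = (padd (nth origin l i) (eps e) \in l).
Proof. by rewrite /nbr; case: ifP. Qed.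

Lemma nbr_inj l i e e' j : nbr l i e = Some j -> nbr l i e' = Some j -> e = e'.
Proof.
by move=> /nbr_padd[_ E] /nbr_padd[_ E']; apply: (@padd_eps_inj (nth origin l i)); rewrite E.
Qed.

Section Config.
Variables (l : seq pos) (k : nat).
Hypothesis cl : is_config l k.

Lemma nbr_of_padd i e j : j < size l -> padd (nth origin l i) (eps e) = nth origin l j ->
  nbr l i e = Some j.
Proof.
by case: cl => _ _ _ Ul _ jl E; rewrite /nbr E mem_nth // index_uniq.
Qed.

Lemma nbr_turn i e j : i < size l -> nbr l i e = Some j -> nbr l j (turn e) = Some i.
Proof.
by move=> il /nbr_padd[jl E]; apply: nbr_of_padd => //; rewrite -E padd_turn.
Qed.

(** A unit step moves, which excludes equal indices, and a configuration has no chords, which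
    excludes indices two or more apart. *)
Lemma nbr_consec i e j : i < size l -> nbr l i e = Some j -> j = i.+1 \/ i = j.+1.
Proof.
case: cl => _ _ _ Ul nadj il /nbr_padd[jl E].
have adj : adjacent (nth origin l i) (nth origin l j) by apply/adjacentP; exists e.
have [ij|ji|ij] := ltngtP i j; last by move: (padd_eps_neq (nth origin l i) e); rewrite E ij eqxx.
- have [|] := ltnP i.+1 j; last by lia.
  by move=> /(nadj _ _ jl); rewrite adj.
- have [|] := ltnP j.+1 i; last by lia.
  by move=> /(nadj _ _ il); rewrite adjacent_sym adj.
Qed.

Lemma nbr_next i : i.+1 < size l -> exists e, nbr l i e = Some i.+1.
Proof.
move=> il; case: cl => _ _ /(_ _ il)/adjacentP[e E] _ _.
by exists e; apply: nbr_of_padd.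
Qed.

Lemma nbr_prev i : i.+1 < size l -> exists e, nbr l i.+1 e = Some i.
Proof.
move=> il; have [e E] := nbr_next il; exists (turn e).
by apply: nbr_turn => //; apply: ltnW.
Qed.

Lemma origin_index i : i < size l -> (nth origin l i == origin) = (i == k).
Proof. by case: cl => kl E _ Ul _ il; rewrite -{2}E nth_uniq. Qed.

Lemma run_nbr A t i : i < size l -> run A l t.+1 (nth origin l i) =
  @delta A (run A l t (nth origin l i))
    [ffun e => omap (fun j => run A l t (nth origin l j)) (nbr l i e)].
Proof.
move=> il /=; congr delta; apply/ffunP => e; rewrite !ffunE /nbr.
by case: ifP => //= lq; rewrite nth_index.
Qed.

(** Truncated subtraction makes [i - k + (k - i)] the distance |i - k| to the general, and activity
    spreads from the general at speed at most one. *)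
Lemma run_quiescent A t i : i < size l -> t < i - k + (k - i) ->
  run A l t (nth origin l i) = qstate A.
Proof.
elim: t i => [|t IH] i il ti; first by rewrite /= origin_index //; case: eqP => // E; lia.
rewrite run_nbr // IH //; last by lia.
apply: qstate_stable => e; rewrite ffunE.
case E: (nbr l i e) => [j|] /=; [right|by left].
have [jl _] := nbr_padd E; have := nbr_consec il E.
by move=> ij; rewrite IH //; lia.
Qed.

End Config.

(** The order of the list does not enter [run], so reversing the list is a symmetry that exchanges
    the two hands. *)
Lemma run_eq_mem A (l l' : seq pos) : l =i l' -> forall t p, run A l t p = run A l' t p.
Proof.
move=> ll'; elim=> [|t IH] p /=.
  by have -> : bc l p = bc l' p by apply/ffunP => e; rewrite !ffunE ll'.
by rewrite IH; congr delta; apply/ffunP => e; rewrite !ffunE ll' IH.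
Qed.

Lemma fires_at_eq_mem A (l l' : seq pos) t : l =i l' -> fires_at A l t -> fires_at A l' t.
Proof.
move=> ll' [nF F]; split=> [t' t't p|p]; rewrite -ll' => lp.
  by rewrite -(run_eq_mem A ll'); apply: nF.
by rewrite -(run_eq_mem A ll'); apply: F.
Qed.

Lemma is_config_rev l k : is_config l k -> is_config (rev l) (size l - 1 - k).
Proof.
case=> kl E adj Ul nadj.
have N i : i < size l -> nth origin (rev l) i = nth origin l (size l - i.+1) by exact: nth_rev.
split; rewrite ?size_rev ?rev_uniq //; first by lia.
- by rewrite N; [rewrite -{2}E; congr nth; lia | lia].
- move=> i il; rewrite !N //; last by lia.
  rewrite adjacent_sym; have -> : size l - i.+1 = (size l - i.+2).+1 by lia.
  by apply: adj; lia.
- move=> i j jl ij; rewrite !N //; last by lia.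
  by rewrite adjacent_sym; apply: nadj; lia.
Qed.

(** * The lower bound *)

Section LeftArm.
Variables (l x0 x1 : seq pos) (k : nat).
Hypotheses (cl : is_config l k) (k_gt0 : 0 < k) (x0_gt0 : 0 < size x0).
Hypothesis W : in_W l k 1 (size l).-1 x0 x1.
Let l' := x0 ++ drop 1 (take (size l).-1.+1 l) ++ x1.

Let k_lt : k < size l. Proof. by case: cl. Qed.

Let cl' : is_config l' (size x0 + (k - 1)). Proof. by case: W. Qed.

Let take_all : take (size l).-1.+1 l = l.
Proof. by rewrite prednK; [exact: take_size | lia]. Qed.

Let size_l' : size l' = size x0 + (size l - 1) + size x1.
Proof. by rewrite /l' take_all !size_cat size_drop addnA. Qed.

Let nth_l' j : 0 < j -> j < size l -> nth origin l' (size x0 + j.-1) = nth origin l j.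
Proof.
move=> j0 jl; rewrite /l' take_all nth_cat ltnNge leq_addr /= addKn nth_cat size_drop.
by rewrite ifT; [rewrite nth_drop add1n prednK | lia].
Qed.

(** The node of index 1 keeps its boundary condition, so its port towards the last node of [x0]
    leads into [l] as well, to index 0 or 2. Index 2 is impossible: that position already follows
    index 1 in [l'], and positions in [l'] are distinct. *)
Lemma in_W_joint : nth origin l' (size x0).-1 = nth origin l 0.
Proof.
have [e Ee] : exists e, nbr l' (size x0) e = Some (size x0).-1.
  by have := @nbr_prev _ _ cl' (size x0).-1; rewrite prednK //; apply; lia.
have [xl P] := nbr_padd Ee.
have N1 : nth origin l' (size x0) = nth origin l 1.
  by rewrite -nth_l' ?addn0 //; lia.
have [_ /(_ 1 (leqnn _))] := W.
have n1 : 0 < (size l).-1 by lia.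
move=> /(_ n1)/ffunP/(_ e); rewrite !ffunE -/l' -N1 P mem_nth // => /esym.
move=> /(nthP origin)[j jl Ej].
have Nj : nbr l 1 e = Some j by apply: (nbr_of_padd cl) => //; rewrite -N1 P Ej.
have l1 : 1 < size l by lia.
have [j2|[j0]] := nbr_consec cl l1 Nj; last by rewrite -Ej -j0.
have: nth origin l' (size x0).-1 == nth origin l' (size x0 + 1).
  by rewrite -Ej j2 -(nth_l' (j := 2)) // -j2 //.
have jl2 : 2 < size l by rewrite -j2.
by rewrite nth_uniq ?size_l'; [lia | lia | lia | case: cl'].
Qed.

(** The initial states agree because the general lies in the preserved part. After that a difference
    can only enter through the node of index 0, which is at distance k from the general and
    quiescent before time k in both configurations; it then needs j steps to reach index j. *)
Lemma in_W_run_eq A t j : 0 < j -> j < size l -> t < k + j ->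
  run A l t (nth origin l j) = run A l' t (nth origin l j).
Proof.
have bcE i : 0 < i -> i < size l -> bc l' (nth origin l i) = bc l (nth origin l i).
  by move=> i0 il; case: W => _; apply; lia.
have memE i e : 0 < i -> i < size l ->
    (padd (nth origin l i) (eps e) \in l') = (padd (nth origin l i) (eps e) \in l).
  by move=> i0 il; have /ffunP/(_ e) := bcE i i0 il; rewrite !ffunE.
elim: t j => [|t IH] j j0 jl tj /=; first by rewrite bcE.
rewrite -IH //; last by lia.
congr delta; apply/ffunP => e; rewrite !ffunE memE //; case: ifP => // /(nthP origin)[i il Ei].
have Ni : nbr l j e = Some i by apply: (nbr_of_padd cl).
have ij := nbr_consec cl jl Ni.
rewrite -Ei; have [i0|] := posnP i; last by move=> i0; rewrite IH //; lia.
rewrite i0 (run_quiescent cl); [|lia|lia].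
by rewrite -in_W_joint (run_quiescent cl') //; lia.
Qed.

End LeftArm.

Lemma left_free_lower_bound l k A t : is_config l k -> left_free l k ->
  solution A -> fires_at A l t -> 0 < k -> k + (size l).-1 <= t.
Proof.
move=> cl lf sA fA k0; rewrite leqNgt; apply/negP => tlt.
(* With at least t + 2 nodes in [x0], the left end of [l'] is more than t steps away from the
   general. *)
case: lf => [k00|[_ /(_ t.+2)[x0 [x1 [W tx]]]]]; first by rewrite k00 in k0.
have kl : k < size l by case: cl.
have x00 : 0 < size x0 by apply: leq_trans tx.
have [cl' _] := W.
have [t' fA'] := sA _ _ cl'.
set l' := x0 ++ _ in cl' fA' *.
have n1 : 0 < (size l).-1 by lia.
have n1l : (size l).-1 < size l by lia.
have E u : u <= t -> run A l u (nth origin l (size l).-1) = run A l' u (nth origin l (size l).-1).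
  by move=> ut; apply: (in_W_run_eq cl) => //; lia.
have pl : nth origin l (size l).-1 \in l by rewrite mem_nth.
have pl' : nth origin l (size l).-1 \in l'.
  rewrite /l' !mem_cat; apply/orP; right; apply/orP; left.
  rewrite prednK; last by lia.
  rewrite take_size; apply/(nthP origin); exists (size l).-2; rewrite ?size_drop; first by rewrite subn1 ltn_predL.
  by rewrite nth_drop; congr nth; lia.
have [nF F] := fA; have [nF' F'] := fA'.
(* The right end of [l] has the same history in both configurations up to time t, so it forces equal
   firing times; but at time t the left end of [l'] is still quiescent. *)
have [t't|tt'|tt'] := ltngtP t' t.
- by move: (nF _ t't _ pl); rewrite E ?F' // ltnW.
- by move: (nF' _ tt' _ pl'); rewrite -E ?F.
have l'0 : 0 < size l' by rewrite size_cat; lia.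
move: (F' _ (mem_nth origin l'0)); rewrite (run_quiescent cl') //; last by lia.
by rewrite (negbTE (@qstate_not_firing A)).
Qed.

Lemma right_free_rev l k : is_config l k -> right_free l k -> left_free (rev l) (size l - 1 - k).
Proof.
move=> cl; have kl : k < size l by case: cl.
case=> [k1|[k1 g_inf]]; [left; lia | right; split; first by lia].
move=> n; have [x0 [x1 [[cW bcW] nx]]] := g_inf n.
exists (rev x1), (rev x0); rewrite (size_rev l); split; last by rewrite size_rev.
have mid : drop 1 (take (size l).-1.+1 (rev l)) = rev (drop 0 (take (size l).-2.+1 l)).
  rewrite !prednK; [|lia|lia]; rewrite drop0 -{1}(size_rev l) take_size.
  by rewrite drop_rev subn1.
set l' := x0 ++ _ in cW bcW.
have revl' : rev x1 ++ drop 1 (take (size l).-1.+1 (rev l)) ++ rev x0 = rev l'.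
  by rewrite mid /l' !rev_cat catA.
split; rewrite revl'.
  have -> : size (rev x1) + (size l - 1 - k - 1) = size l' - 1 - (size x0 + (k - 0)).
    by rewrite size_rev /l' !size_cat drop0 size_takel; lia.
  exact: is_config_rev.
move=> j j1 jn; rewrite nth_rev; last by lia.
have /ffunP E := bcW (size l - j.+1) isT ltac:(lia).
by apply/ffunP => e; have := E e; rewrite !ffunE !mem_rev.
Qed.

(** The two hands give 2k + s and k + 2s. An arm of length 0 gives no bound, but then the other one
    is the larger, or the claim is 0. *)
Lemma type_I_lower_bound l k A t : is_config l k -> type_I l k -> solution A ->
  fires_at A l t -> k + (size l - 1 - k) + maxn k (size l - 1 - k) <= t.
Proof.
move=> cl [lf rf] sA fA; have kl : k < size l by case: cl.
have clr := is_config_rev cl.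
have fAr : fires_at A (rev l) t by apply: fires_at_eq_mem fA => p; rewrite mem_rev.
have := left_free_lower_bound cl lf sA fA.
have := left_free_lower_bound clr (right_free_rev cl rf) sA fAr.
by rewrite size_rev; lia.
Qed.

(** * A solution of arbitrary speed *)

Inductive msg := mNone | mSeek | mFast | mSlow | mMid | mPre.

Definition msg_code m :=
  match m with mNone => 0 | mSeek => 1 | mFast => 2 | mSlow => 3 | mMid => 4 | mPre => 5 end.
Definition msg_decode n := nth mNone [:: mNone; mSeek; mFast; mSlow; mMid; mPre] n.
Lemma msg_codeK : cancel msg_code msg_decode. Proof. by case. Qed.
HB.instance Definition _ := Equality.copy msg (can_type msg_codeK).

(* A token [Seek] runs from the general to one end, which becomes a [Gen]: the only
   active cell of a segment bounded by walls.  A [Gen] emits a signal of speed 1 ([Fast],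
   reflected at the other end) and one of speed 1/3 ([Slow0], [Slow1], [Slow2]); they
   meet in the middle.  In a segment of even size the first of the two middle cells
   becomes [MidE] and then both become [Gen], with a wall between them; in a segment of
   odd size the middle cell becomes [Mid], then [Dead], and its two neighbours become
   [Gen].  Hence all segments have the same size at all times, and when it is 1 all the
   [Gen] turn [Pre], then [Fire] together with the [Dead] cells.  A direction argument
   is the one in which the signal travels (for [MidE]: that of the other middle cell). *)
Inductive kind :=
  | Quiet | Gen | Mid | Dead | Pre | Fire
  | Seek of 'I_4 | Fast of 'I_4 | Slow0 of 'I_4 | Slow1 of 'I_4 | Slow2 of 'I_4 | MidE of 'I_4.

Definition kind_code (x : kind) : 'I_6 + 'I_6 * 'I_4 :=
  match x with
  | Quiet => inl (inord 0) | Gen => inl (inord 1) | Mid => inl (inord 2)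
  | Dead => inl (inord 3) | Pre => inl (inord 4) | Fire => inl (inord 5)
  | Seek d => inr (inord 0, d) | Fast d => inr (inord 1, d) | Slow0 d => inr (inord 2, d)
  | Slow1 d => inr (inord 3, d) | Slow2 d => inr (inord 4, d) | MidE d => inr (inord 5, d)
  end.
Definition kind_decode (z : 'I_6 + 'I_6 * 'I_4) : kind :=
  match z with
  | inl i => nth Quiet [:: Quiet; Gen; Mid; Dead; Pre; Fire] i
  | inr (i, d) => nth Quiet [:: Seek d; Fast d; Slow0 d; Slow1 d; Slow2 d; MidE d] i
  end.
Lemma kind_codeK : cancel kind_code kind_decode.
Proof. by case=> *; rewrite /= inordK. Qed.
HB.instance Definition _ := Equality.copy kind (can_type kind_codeK).
HB.instance Definition _ := Choice.copy kind (can_type kind_codeK).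
HB.instance Definition _ := Countable.copy kind (can_type kind_codeK).
HB.instance Definition _ := Finite.copy kind (can_type kind_codeK).

(** Walls are not consulted here: [recv] applies only those of the receiver. So a [Pre] behind its
    own wall is still heard by the adjacent [Dead] cell, which has no wall on that side. *)
Definition send (x : kind) (e : 'I_4) : msg :=
  match x with
  | Gen => mFast | Mid => mMid | Pre => mPre
  | Seek d => if e == d then mSeek else mNone
  | Fast d => if e == d then mFast else mNone
  | Slow2 d => if e == d then mSlow else mNone
  | MidE d => if e == d then mMid else mNone
  | _ => mNone
  end.

Definition walls := {ffun 'I_4 -> bool}.
Definition no_walls : walls := [ffun=> false].
Definition add_wall (w : walls) e : walls := [ffun f => (f == e) || w f].
Definition cell : finType := (kind * walls)%type.

Definition is_open (w : walls) (nb : {ffun 'I_4 -> option cell}) e := ~~ w e && isSome (nb e).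
Definition recv (w : walls) (nb : {ffun 'I_4 -> option cell}) e : msg :=
  if w e then mNone else if nb e is Some s then send s.1 (turn e) else mNone.

(** [from m] is a port at which [m] comes in, and [other e] an open port different from [e]; if
    there is none, [Fast] is reflected and [Seek] has found an end. [mSlow] and [mFast] arriving
    together mark the middle of a segment of odd size. *)
Definition receive (from : msg -> option 'I_4) (other : 'I_4 -> option 'I_4) (w : walls) : cell :=
  if from mMid is Some e then (Gen, add_wall w e)
  else if from mSlow is Some e then
    (if from mFast is Some _ then Mid else if other e is Some f then Slow0 f else Quiet, w)
  else if from mFast is Some e then (Fast (odflt e (other e)), w)
  else if from mSeek is Some e then (if other e is Some f then Seek f else Gen, w)
  else (Quiet, w).

Lemma receive_ext f f' g g' w : (forall m, m != mNone -> f m = f' m) ->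
  (forall m e, f' m = Some e -> g e = g' e) -> receive f g w = receive f' g' w.
Proof.
move=> ff' gg'; rewrite /receive !ff' //.
case: (f' mMid) => //; case E2: (f' mSlow) => [e|]; first by rewrite (gg' _ _ E2).
case E3: (f' mFast) => [e|]; first by rewrite (gg' _ _ E3).
by case E4: (f' mSeek) => [e|] //; rewrite (gg' _ _ E4).
Qed.

Definition passive (x : kind) :=
  match x with Quiet | Seek _ | Fast _ | Slow2 _ => true | _ => false end.

(** A [Gen] continues as [Slow1], since its own time step counts as the first of the three that the
    slow signal spends on a cell. A [Slow1] that hears the fast signal from ahead has found the
    middle of a segment of even size. *)
Definition sdelta (s : cell) (nb : {ffun 'I_4 -> option cell}) : cell :=
  let: (x, w) := s in
  match x with
  | Gen => (if [pick e | is_open w nb e] is Some e then Slow1 e else Pre, w)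
  | Slow0 d => (Slow1 d, w)
  | Slow1 d => (if recv w nb d == mFast then MidE d else Slow2 d, w)
  | Mid => (Dead, w)
  | MidE d => (Gen, add_wall w d)
  | Dead => (if [exists e, recv w nb e == mPre] then Fire else Dead, w)
  | Pre | Fire => (Fire, w)
  | _ => receive (fun m => [pick e | recv w nb e == m])
                 (fun e => [pick f | is_open w nb f && (f != e)]) w
  end.

Definition sgen (b : {ffun 'I_4 -> bool}) : cell :=
  (if [pick e | b e] is Some e then Seek e else Gen, no_walls).

Definition is_fire (s : cell) := if s.1 is Fire then true else false.
Definition is_pre (s : cell) := if s.1 is Pre then true else false.

Lemma pick_some (T : finType) (P : pred T) (x : T) : P x -> (forall y, P y -> y = x) -> [pick y | P y] = Some x.
Proof.
move=> Px uP; case: pickP => [y /uP->//|/(_ x)]; by rewrite Px.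
Qed.

Lemma pick_none (T : finType) (P : pred T) : P =1 xpred0 -> [pick y | P y] = None.
Proof. by move=> P0; case: pickP => // x; rewrite P0. Qed.

Lemma sdelta_quiet (nb : {ffun 'I_4 -> option cell}) : (forall e, nb e = None \/ nb e = Some (Quiet, no_walls)) ->
  sdelta (Quiet, no_walls) nb = (Quiet, no_walls).
Proof.
move=> H; have r e : recv no_walls nb e = mNone.
  by rewrite /recv ffunE; case: (H e) => ->.
by rewrite /= /receive !pick_none // => e; rewrite r.
Qed.

Definition slow : automaton :=
  @Automaton cell (Quiet, no_walls) #|{ffun 'I_4 -> bool}| (fun i => sgen (enum_val i)) is_fire
    enum_rank sdelta isT sdelta_quiet.

(* At most two ports [R] and [L] are open, and [mR] and [mL] are the messages received
   there.  [sdelta] inspects ports in the order of ['I_4]; the lemmas below show that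
   this order is irrelevant, so that a segment may be read in either direction. *)
Section LocalStep.
Variables (w : walls) (nb : {ffun 'I_4 -> option cell}) (R L : option 'I_4) (mR mL : msg).
Hypothesis openE : forall e, is_open w nb e = (R == Some e) || (L == Some e).
Hypothesis recvE : forall e, recv w nb e =
  if R == Some e then mR else if L == Some e then mL else mNone.
Hypotheses (RL : R = L -> R = None) (R0 : R = None -> mR = mNone) (L0 : L = None -> mL = mNone).

(** Unless both sides send the same message, each [pick] in [sdelta] has at most one candidate, so
    the numbering of the ports has no influence. *)
Lemma sdelta_passive x : passive x -> (mR = mL -> mR = mNone) -> sdelta (x, w) nb =
  receive (fun m => if mR == m then R else if mL == m then L else None)
          (fun e => if R == Some e then L else R) w.
Proof.
move=> px RLm.
have from m : m != mNone -> [pick e | recv w nb e == m] =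
    if mR == m then R else if mL == m then L else None.
  move=> m0; have [Rm|Rm] := eqVneq mR m.
    case ER : R R0 => [b|] R0'; last by rewrite -Rm R0' ?eqxx in m0.
    apply: pick_some; first by rewrite recvE ER eqxx Rm.
    move=> e; rewrite recvE ER; case: ifP => [/eqP[->]//|_]; case: ifP => _; last by rewrite eq_sym (negbTE m0).
    by move/eqP => Lm; rewrite -Rm RLm ?eqxx // in m0; rewrite Lm.
  have [Lm|Lm] := eqVneq mL m.
    case EL : L L0 => [a|] L0'; last by rewrite -Lm L0' ?eqxx in m0.
    apply: pick_some; first by rewrite recvE EL eqxx; case: ifP => [/eqP E|_]; rewrite ?Lm //; move: RL; rewrite E EL => /(_ erefl).
    move=> e; rewrite recvE EL; case: ifP => [_|_]; first by rewrite (negbTE Rm).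
    by case: ifP => [/eqP[->]//|_]; rewrite eq_sym (negbTE m0).
  apply: pick_none => e; rewrite recvE; case: ifP => _; first by rewrite (negbTE Rm).
  by case: ifP => _; rewrite ?(negbTE Lm) // eq_sym (negbTE m0).
have other e : (R == Some e) || (L == Some e) ->
    [pick f | is_open w nb f && (f != e)] = if R == Some e then L else R.
  have [Re _|Re /= /eqP Le] := eqVneq R (Some e).
    case EL : L => [a|].
      have ae : a != e by apply/eqP => ae; move: RL; rewrite Re EL ae => /(_ erefl).
      apply: pick_some; first by rewrite openE EL eqxx orbT.
      by move=> f; rewrite openE Re EL => /andP[/orP[]/eqP[->]//]; rewrite eqxx.
    by apply: pick_none => f; rewrite openE Re EL orbF; apply/andP => -[/eqP[->]]; rewrite eqxx.
  case ER : R Re => [b|] Re.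
    have be : b != e by apply: contra Re => /eqP->.
    apply: pick_some; first by rewrite openE ER eqxx.
    by move=> f; rewrite openE Le ER => /andP[/orP[]/eqP[->]//]; rewrite eqxx.
  by apply: pick_none => f; rewrite openE Le ER /=; apply/andP => -[/eqP[->]]; rewrite eqxx.
have -> : sdelta (x, w) nb = receive (fun m => [pick e | recv w nb e == m])
    (fun e => [pick f | is_open w nb f && (f != e)]) w by case: x px.
apply: receive_ext => // m e E; apply: other; move: E.
by case: ifP => _; [|case: ifP => _ //] => ->; rewrite eqxx ?orbT.
Qed.

Lemma sdelta_gen : L = None ->
  sdelta (Gen, w) nb = (if R is Some b then Slow1 b else Pre, w).
Proof.
move=> LN; have E : [pick e | is_open w nb e] = R.
  case ER : R => [b|].
    apply: pick_some; first by rewrite openE ER eqxx.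
    by move=> f; rewrite openE ER LN orbF => /eqP[].
  by apply: pick_none => f; rewrite openE ER LN.
by rewrite /= E.
Qed.

Lemma sdelta_slow1 b : R = Some b ->
  sdelta (Slow1 b, w) nb = (if mR == mFast then MidE b else Slow2 b, w).
Proof. by move=> Rb; rewrite /= recvE Rb eqxx. Qed.

Lemma sdelta_dead :
  sdelta (Dead, w) nb = (if (mR == mPre) || (mL == mPre) then Fire else Dead, w).
Proof.
rewrite /=; congr (if _ then _ else _, _); apply/existsP/orP.
  case=> e; rewrite recvE; case: ifP => _ mP; first by left.
  by move: mP; case: ifP => // _; right.
case=> /eqP E.
  case ER : R R0 => [b|] R0'; last by rewrite R0' in E.
  by exists b; rewrite recvE ER eqxx E.
case EL : L L0 => [a|] L0'; last by rewrite L0' in E.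
exists a; rewrite recvE EL eqxx; case: ifP => [/eqP Ra|_]; last by rewrite E.
by move: RL; rewrite Ra EL => /(_ erefl).
Qed.

End LocalStep.

(* A segment: cell [j] is the node of index [c j], its walls are [w j], and [u j] is the
   direction to cell [j.+1].  All other ports of its cells are closed. *)
Record chain (l : seq pos) (d : nat) (c : nat -> nat) (u : nat -> 'I_4) (w : nat -> walls) : Prop := Chain {
  chain_lt : forall j, j < d -> c j < size l;
  chain_fwd : forall j, j.+1 < d -> nbr l (c j) (u j) = Some (c j.+1);
  chain_bwd : forall j, j.+1 < d -> nbr l (c j.+1) (turn (u j)) = Some (c j);
  chain_turn : forall j, j.+2 < d -> u j.+1 != turn (u j);
  chain_open : forall j e, j < d ->
    ~~ w j e && isSome (nbr l (c j) e) =
    ((j.+1 < d) && (u j == e)) || ((0 < j) && (turn (u j.-1) == e)) }.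

(** After a split the first half starts from its last cell. Reading it backwards puts the new [Gen]
    at cell 0, as for the second half. *)
Lemma chain_rev l d c u w : chain l d c u w ->
  chain l d (fun j => c (d.-1 - j)) (fun j => turn (u (d.-2 - j))) (fun j => w (d.-1 - j)).
Proof.
move=> [H1 H2 H3 H4 H5]; split.
- by move=> j jd; rewrite H1 //; lia.
- move=> j jd; have -> : d.-1 - j = (d.-2 - j).+1 by lia.
  by rewrite H3; [congr (Some (c _)); lia | lia].
- move=> j jd; rewrite turnK; have -> : d.-1 - j = (d.-2 - j).+1 by lia.
  have -> : d.-1 - j.+1 = d.-2 - j by lia.
  by rewrite H2 //; lia.
- move=> j jd; rewrite turnK; have -> : d.-2 - j = (d.-2 - j.+1).+1 by lia.
  by rewrite eq_sym H4 //; lia.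
- move=> j e jd; rewrite H5; last by lia.
  rewrite orbC turnK; congr orb.
    have -> : (0 < d.-1 - j) = (j.+1 < d) by lia.
    by have -> : (d.-1 - j).-1 = d.-2 - j by lia.
  have -> : ((d.-1 - j).+1 < d) = (0 < j) by lia.
  by case: j jd => //= j jd; have -> : d.-1 - j.+1 = d.-2 - j by lia.
Qed.

Lemma chain_take l d c u w m : chain l d c u w -> 0 < m < d ->
  chain l m c u (fun j => if j == m.-1 then add_wall (w j) (u j) else w j).
Proof.
move=> [H1 H2 H3 H4 H5] md; split.
- by move=> j jd; rewrite H1 //; lia.
- by move=> j jd; rewrite H2 //; lia.
- by move=> j jd; rewrite H3 //; lia.
- by move=> j jd; rewrite H4 //; lia.
- move=> j e jm; have jd : j < d by lia.
  have jd1 : j.+1 < d by lia.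
  have := H5 j e jd; case: (eqVneq j m.-1) => jE; rewrite jd1 /=; last first.
    by have -> : j.+1 < m by lia.
  have -> : (j.+1 < m) = false by lia.
  rewrite ffunE negb_or -andbA => ->; rewrite eq_sym; case: eqP => //= E.
  by case: j {jE} jm jd jd1 E => //= j jm jd jd1 <-; rewrite eq_sym (negbTE (H4 _ _)).
Qed.

Lemma chain_drop l d c u w m : chain l d c u w -> 0 < m < d ->
  chain l (d - m) (fun j => c (m + j)) (fun j => u (m + j))
    (fun j => if j == 0 then add_wall (w m) (turn (u m.-1)) else w (m + j)).
Proof.
move=> [H1 H2 H3 H4 H5] md; split.
- by move=> j jd; rewrite H1 //; lia.
- by move=> j jd; rewrite addnS H2 //; lia.
- by move=> j jd; rewrite addnS H3 //; lia.
- by move=> j jd; rewrite addnS H4 //; lia.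
- move=> j e jm; have jd : m + j < d by lia.
  have := H5 (m + j) e jd.
  have -> : (j.+1 < d - m) = ((m + j).+1 < d) by lia.
  have -> : 0 < m + j by lia.
  case: j jm jd => [|j] jm jd /=; last first.
    by have -> : (m + j.+1).-1 = m + j by lia.
  rewrite addn0 ffunE negb_or -andbA => ->; rewrite orbF eq_sym.
  case: eqP => //= E; last by rewrite orbF.
  apply/esym/negbTE; rewrite negb_and; case: ltnP => //= dm.
  by rewrite -E; have := H4 m.-1; rewrite prednK; [apply; lia | lia].
Qed.

(** * One step of a cell inside a segment *)

Section Trajectory.
Variable l : seq pos.
Let X t i : cell := run slow l t (nth origin l i).

Section Step.
Variables (d : nat) (c : nat -> nat) (u : nat -> 'I_4) (w : nat -> walls).
Hypothesis ch : chain l d c u w.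
Variables (t j : nat) (x : kind).
Hypotheses (jd : j < d) (Xj : X t (c j) = (x, w j)).

Let R := if j.+1 < d then Some (u j) else None.
Let L := if 0 < j then Some (turn (u j.-1)) else None.
Let mR := if j.+1 < d then send (X t (c j.+1)).1 (turn (u j)) else mNone.
Let mL := if 0 < j then send (X t (c j.-1)).1 (u j.-1) else mNone.
Let nb := [ffun e => omap (X t) (nbr l (c j) e)].

Let XS : X t.+1 (c j) = sdelta (x, w j) nb.
Proof. by rewrite /X run_nbr ?(chain_lt ch) // -/(X t (c j)) Xj. Qed.

Let openE e : is_open (w j) nb e = (R == Some e) || (L == Some e).
Proof.
rewrite /is_open ffunE; have := chain_open ch e jd; rewrite /R /L.
case: (nbr l (c j) e) => [i|] /= ->; case: ltnP => _; case: ltnP => _ //=.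
Qed.

Let recvE e : recv (w j) nb e =
  if R == Some e then mR else if L == Some e then mL else mNone.
Proof.
have := openE e; rewrite /is_open /recv; case: (w j e) => /=.
  by move/esym/norP => [/negbTE-> /negbTE->].
have [/eqP|_] := ifPn.
  rewrite /R /mR; case: ltnP => // jd1 [<-] _.
  by rewrite ffunE (chain_fwd ch).
have [/eqP|_] := ifPn.
  rewrite /L /mL; case: ltnP => // j0 [<-] _.
  have -> : nb (turn (u j.-1)) = Some (X t (c j.-1)).
    by rewrite ffunE; have := chain_bwd ch (j := j.-1); rewrite prednK // => ->.
  by rewrite turnK.
by case: (nb e).
Qed.

Let RL : R = L -> R = None.
Proof.
rewrite /R /L; case: ltnP => // jd1; case: ltnP => // j0 [E].
by have := chain_turn ch (j := j.-1); rewrite prednK // => /(_ jd1); rewrite E eqxx.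
Qed.

Let R0 : R = None -> mR = mNone. Proof. by rewrite /R /mR; case: ltnP. Qed.
Let L0 : L = None -> mL = mNone. Proof. by rewrite /L /mL; case: ltnP. Qed.

Lemma step_passive : passive x -> (mR = mL -> mR = mNone) ->
  X t.+1 (c j) = receive (fun m => if mR == m then R else if mL == m then L else None)
                         (fun e => if R == Some e then L else R) (w j).
Proof. by move=> px mRL; rewrite XS (sdelta_passive openE recvE). Qed.

Lemma step_gen : x = Gen -> j = 0 -> X t.+1 (c j) = (if R is Some b then Slow1 b else Pre, w j).
Proof. by move=> xE j0; rewrite XS xE (sdelta_gen openE) // /L j0. Qed.

Lemma step_slow0 b : x = Slow0 b -> X t.+1 (c j) = (Slow1 b, w j).
Proof. by rewrite XS => ->. Qed.

Lemma step_slow1 : x = Slow1 (u j) -> j.+1 < d ->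
  X t.+1 (c j) = (if mR == mFast then MidE (u j) else Slow2 (u j), w j).
Proof. by move=> xE jd1; rewrite XS xE (sdelta_slow1 recvE) // /R jd1. Qed.

Lemma step_mid : x = Mid -> X t.+1 (c j) = (Dead, w j).
Proof. by rewrite XS => ->. Qed.

Lemma step_midE b : x = MidE b -> X t.+1 (c j) = (Gen, add_wall (w j) b).
Proof. by rewrite XS => ->. Qed.

Lemma step_dead : x = Dead ->
  X t.+1 (c j) = (if (mR == mPre) || (mL == mPre) then Fire else Dead, w j).
Proof. by rewrite XS => ->; apply: (sdelta_dead recvE). Qed.

Lemma step_pre : x = Pre -> X t.+1 (c j) = (Fire, w j).
Proof. by rewrite XS => ->. Qed.

End Step.
End Trajectory.

Definition slow_state (l : seq pos) t i : cell := run slow l t (nth origin l i).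

(* The content of cell [j] of a segment of size [d] at time [t] after its [Gen], at cell 0,
   was created, until the two signals meet; [u j] is the direction from [j] to [j.+1]. *)
Definition stage (d : nat) (u : nat -> 'I_4) (t j : nat) : kind :=
  if t == 0 then (if j == 0 then Gen else Quiet)
  else if j == t %/ 3 then
    (if t %% 3 == 0 then Slow0 (u j) else if t %% 3 == 1 then Slow1 (u j) else Slow2 (u j))
  else if (j == t) && (t.+1 < d) then Fast (u j)
  else if (0 < j) && (d <= t.+1) && (j + t == 2 * d.-1) then Fast (turn (u j.-1))
  else Quiet.

(** * The two signals up to their meeting *)

Section Stage.
Variables (l : seq pos) (d : nat) (c : nat -> nat) (u : nat -> 'I_4) (w : nat -> walls).
Hypothesis ch : chain l d c u w.
Variable t0 : nat.
Let X t := slow_state l (t0 + t).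

Lemma stage_right t j : j.+1 < d -> send (stage d u t j) (u j) =
  if j == t then mFast else if (j == t %/ 3) && (t %% 3 == 2) then mSlow else mNone.
Proof.
move=> jd; rewrite /stage; have [->|tp] := posnP t.
  by case: j jd => [|j] jd //=; rewrite div0n.
have [jq|jq] := eqVneq j (t %/ 3) => /=.
  have -> : (j == t) = false by lia.
  have [r0|r0] := eqVneq (t %% 3) 0; first by rewrite r0.
  have [r1|r1] := eqVneq (t %% 3) 1; first by rewrite r1.
  by have -> : t %% 3 == 2; [lia | rewrite /= eqxx].
have [jt|jt] := eqVneq j t => /=; first by rewrite -jt jd /= eqxx.
case: ifP => //= /andP[/andP[j0 _] _].
have := chain_turn ch (j := j.-1); rewrite prednK // => /(_ jd).
by case: ifP.
Qed.

(** The bound on [t] says that the signals have not met: the slow one is at cell t / 3, and the fast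
    one, once reflected, at cell 2(d-1) - t. *)
Lemma stage_left t j : 0 < j < d -> t + t %/ 3 < 2 * d.-1 -> send (stage d u t j) (turn (u j.-1)) =
  if (d <= t.+1) && (j + t == 2 * d.-1) then mFast else mNone.
Proof.
move=> /andP[j0 jd] tv; rewrite /stage.
have tu : j.+1 < d -> (turn (u j.-1) == u j) = false.
  move=> jd1; have := chain_turn ch (j := j.-1); rewrite prednK // eq_sym => /(_ jd1).
  by move/negbTE.
have [->|tp] := posnP t.
  by rewrite (gtn_eqF j0) /=; case: ifP => //; lia.
have [jq|jq] := eqVneq j (t %/ 3) => /=.
  have -> : (d <= t.+1) && (j + t == 2 * d.-1) = false by lia.
  case: ifP => _ //=; case: ifP => _ //=; rewrite tu //; lia.
have [jt|jt] := eqVneq j t => /=.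
  rewrite -jt; case: ltnP => jd1 /=; first by rewrite tu //; case: ifP => //; lia.
  by rewrite j0 /=; case: ifP => //=; rewrite eqxx.
by rewrite j0 /=; case: ifP => //=; rewrite eqxx.
Qed.

Section Step.
Variable t : nat.
Hypothesis Xt : forall j, j < d -> X t (c j) = (stage d u t j, w j).
Hypothesis tv : t + t %/ 3 < 2 * d.-1.

Let mR j := if j.+1 < d then
  if (d <= t.+1) && (j.+1 + t == 2 * d.-1) then mFast else mNone else mNone.
Let mL j := if 0 < j then
  if j == t.+1 then mFast else if (j == (t %/ 3).+1) && (t %% 3 == 2) then mSlow else mNone
  else mNone.

Let mRE j : j < d ->
  (if j.+1 < d then send (X t (c j.+1)).1 (turn (u j)) else mNone) = mR j.
Proof.
move=> jd; rewrite /mR; case: ltnP => // jd1.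
by rewrite Xt // (stage_left (j := j.+1)).
Qed.

Let mLE j : j < d ->
  (if 0 < j then send (X t (c j.-1)).1 (u j.-1) else mNone) = mL j.
Proof.
move=> jd; rewrite /mL; case: j jd => //= j jd.
by rewrite Xt ?stage_right // ltnW.
Qed.

Let mRL j : mR j = mL j -> mR j = mNone.
Proof.
rewrite /mR /mL; case: ltnP => // jd; case: ifP => // /andP[H1 H2].
case: ifP => // j0; case: eqP => // jt; [lia | by case: ifP].
Qed.

Lemma stage_passive j : j < d -> passive (stage d u t j) -> X t.+1 (c j) =
  receive (fun m => if mR j == m then (if j.+1 < d then Some (u j) else None)
                    else if mL j == m then (if 0 < j then Some (turn (u j.-1)) else None)
                    else None)
          (fun e => if (if j.+1 < d then Some (u j) else None) == Some e
                    then (if 0 < j then Some (turn (u j.-1)) else None)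
                    else (if j.+1 < d then Some (u j) else None)) (w j).
Proof.
move=> jd pj; rewrite /X addnS /slow_state (step_passive ch jd (Xt jd) pj).
  by rewrite mRE // mLE.
by rewrite mRE // mLE //; apply: mRL.
Qed.

(** The last two hypotheses exclude the meeting of the signals on cell [j] and a return of the
    reflected signal to cell 0. *)
Lemma stage_passive_next j : j < d -> passive (stage d u t j) ->
  (mL j == mSlow -> mR j = mNone) -> (j == 0 -> mR j = mNone) ->
  X t.+1 (c j) = (if mL j == mSlow then (if j.+1 < d then Slow0 (u j) else Quiet)
                  else if mL j == mFast then (if j.+1 < d then Fast (u j) else Fast (turn (u j.-1)))
                  else if mR j == mFast then Fast (turn (u j.-1)) else Quiet, w j).
Proof.
move=> jd pj sl j0; rewrite stage_passive // /receive.
have ut : 0 < j -> j.+1 < d -> (u j == turn (u j.-1)) = false.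
  move=> jp jd1; have := chain_turn ch (j := j.-1); rewrite prednK // => /(_ jd1).
  by move/negbTE.
have mRc : mR j = mNone \/ (mR j = mFast /\ j.+1 < d).
  by rewrite /mR; case: ltnP => _; [case: ifP; [right|left]|left].
have mLc : mL j = mNone \/ ((mL j = mFast \/ mL j = mSlow) /\ 0 < j).
  rewrite /mL; case: ltnP => _; [|by left]; case: ifP; first by right; split=> //; left.
  by case: ifP; [right; split=> //; right|left].
have := @mRL j.
case: mRc sl j0 => [->|[-> jd1]] sl j0; case: mLc sl j0 => [->|[[->|->] jp]] //= sl j0 H.
- by rewrite jp /=; case: ltnP => jd1 //=; rewrite (inj_eq Some_inj) ut.
- by rewrite jp /=; case: ltnP => jd1 //=; rewrite (inj_eq Some_inj) ut.
- rewrite jd1 /= eqxx; case: ltnP => // j00.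
  by have /j0 : j == 0 by lia.
- by have := H erefl.
- by have := sl isT.
Qed.

Lemma stage_next j : j < d -> t.+1 + t.+1 %/ 3 < 2 * d.-1 ->
  X t.+1 (c j) = (stage d u t.+1 j, w j).
Proof.
move=> jd tv1; have d1 : 1 < d by lia.
have [j0|tj] := boolP ((t == 0) && (j == 0)).
  move: j0 jd => /andP[/eqP t00 /eqP ->] jd.
  rewrite /X addnS /slow_state (step_gen ch jd (Xt jd)) ?t00 //.
  by rewrite d1.
have [/andP[/eqP js sl]|nsl] := boolP ((j == t %/ 3) && (t %% 3 < 2)).
  have tp : 0 < t by lia.
  have st : stage d u t j = if t %% 3 == 0 then Slow0 (u j) else Slow1 (u j).
    rewrite /stage gtn_eqF // js eqxx; case: ifP => // r0.
    by have -> : t %% 3 == 1 by lia.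
  have st1 : stage d u t.+1 j = if t %% 3 == 0 then Slow1 (u j) else Slow2 (u j).
    rewrite /stage /=; have -> : j == t.+1 %/ 3 by lia.
    have -> : (t.+1 %% 3 == 0) = false by lia.
    by have -> : (t.+1 %% 3 == 1) = (t %% 3 == 0) by lia.
  rewrite st1; have jd1 : j.+1 < d by lia.
  have := Xt jd; rewrite st /X addnS; case: ifP => r0 Xj.
    by rewrite /slow_state (step_slow0 ch jd Xj erefl).
  rewrite /slow_state (step_slow1 ch jd Xj) // mRE // /mR jd1.
  (* A fast signal arriving here would be the meeting of the even case, which [tv1] places later. *)
  by have -> : (d <= t.+1) && (j.+1 + t == 2 * d.-1) = false by lia.
have pj : passive (stage d u t j).
  rewrite /stage; have [t00|tp] := posnP t; first by rewrite t00 /= in tj; rewrite (negbTE tj).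
  case: eqP nsl => [->|_ _]; last by case: ifP => // _; case: ifP.
  rewrite /= -leqNgt => r2; have -> : (t %% 3 == 0) = false by lia.
  by have -> : (t %% 3 == 1) = false by lia.
rewrite stage_passive_next //; first last.
- by move/eqP => ->; rewrite /mR; case: ifP => //; case: ifP => //; lia.
- by rewrite /mL /mR; case: ifP => // _; case: ifP => // _; case: ifP => // H _; case: ifP => //; case: ifP => //; lia.
congr pair; rewrite /mL /mR /stage /=.
have [j1|j1] := eqVneq j t.+1.
  subst j; rewrite /=; have -> : (t.+1 == t.+1 %/ 3) = false by lia.
  case: ltnP => jd1 //=.
  by have -> : t.+1 + t.+1 == 2 * d.-1 by lia.
have [/andP[/eqP j2 r2]|nj2] := boolP ((j == (t %/ 3).+1) && (t %% 3 == 2)).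
  have -> : j == t.+1 %/ 3 by lia.
  have -> : t.+1 %% 3 == 0 by lia.
  have -> : 0 < j by lia.
  by have -> : j.+1 < d by lia.
have -> : (j == t.+1 %/ 3) = false by lia.
rewrite if_same /=.
case: ltnP => jd1; last first.
  by rewrite /=; case: ifP => //; lia.
have -> : (0 < j) && (d <= t.+2) && (j + t.+1 == 2 * d.-1) =
  (d <= t.+1) && (j.+1 + t == 2 * d.-1) by lia.
by case: (_ && (_ == 2 * d.-1)).
Qed.

End Step.

Hypothesis Xstart : forall j, j < d -> X 0 (c j) = (if j == 0 then Gen else Quiet, w j).

Lemma stage_run t : (0 < t -> t + t %/ 3 < 2 * d.-1) -> forall j, j < d -> X t (c j) = (stage d u t j, w j).
Proof.
elim: t => [|t IH] tv j jd; first exact: Xstart.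
have tv1 := tv isT.
by apply: (stage_next _ _ jd) => // [i id|]; [apply: IH => // _ |]; lia.
Qed.

(** At time 3m - 2 the slow signal is in its [Slow1] step on cell m - 1 and the reflected one is on
    cell 2(2m-1) - (3m-2) = m, right in front of it. *)
Lemma stage_even m : d = 2 * m -> 0 < m -> forall j, j < d ->
  X (3 * m - 1) (c j) = (if j == m.-1 then MidE (u j) else Quiet, w j).
Proof.
move=> dm m0 j jd; have -> : 3 * m - 1 = (3 * m - 2).+1 by lia.
set t := 3 * m - 2; have tv : t + t %/ 3 < 2 * d.-1 by lia.
have Xt := stage_run (fun _ => tv).
have [jm|jm] := eqVneq j m.-1.
  have st : stage d u t j = Slow1 (u j).
    rewrite /stage; have -> : (t == 0) = false by lia.
    have -> : j == t %/ 3 by lia.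
    have -> : (t %% 3 == 0) = false by lia.
    by have -> : (t %% 3 == 1) by lia.
  have jd1 : j.+1 < d by lia.
  rewrite /X addnS /slow_state (step_slow1 ch jd (Xt _ jd)) // jd1.
  have -> : run slow l (t0 + t) (nth origin l (c j.+1)) = X t (c j.+1) by [].
  rewrite Xt // (stage_left (j := j.+1)) //.
  by have -> : (d <= t.+1) && (j.+1 + t == 2 * d.-1) by lia.
have tp : (t == 0) = false by lia.
rewrite (stage_passive_next Xt tv jd).
- case: (ltnP 0 j) => j0; case: (ltnP j.+1 d) => jd1 /=.
  + have -> : (j == t.+1) = false by lia.
    have -> : (t %% 3 == 2) = false by lia.
    rewrite andbF /=.
    by have -> : (d <= t.+1) && (j.+1 + t == 2 * d.-1) = false by lia.
  + have -> : (j == t.+1) = false by lia.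
    have -> : (t %% 3 == 2) = false by lia.
    by rewrite andbF /=.
  + by have -> : (d <= t.+1) && (j.+1 + t == 2 * d.-1) = false by lia.
  + by [].
- rewrite /stage tp; have -> : (j == t %/ 3) = false by lia.
  by case: ifP => // _; case: ifP.
- case: ifP => // j0; have -> : (t %% 3 == 2) = false by lia.
  by rewrite andbF; case: ifP.
- by move=> j0; case: ifP => // jd1; case: ifP => //; lia.
Qed.

(** At time 3m - 1 the slow signal leaves cell m - 1 and the reflected one leaves cell 4m - (3m-1) =
    m + 1, so both enter cell m. *)
Lemma stage_odd m : d = (2 * m).+1 -> 0 < m -> forall j, j < d ->
  X (3 * m) (c j) = (if j == m then Mid else Quiet, w j).
Proof.
move=> dm m0 j jd; have -> : 3 * m = (3 * m - 1).+1 by lia.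
set t := 3 * m - 1; have tv : t + t %/ 3 < 2 * d.-1 by lia.
have Xt := stage_run (fun _ => tv).
have tp : (t == 0) = false by lia.
have r2 : t %% 3 == 2 by lia.
have pj : passive (stage d u t j).
  rewrite /stage tp; case: ifP => _; last by case: ifP => // _; case: ifP.
  have -> : (t %% 3 == 0) = false by lia.
  by have -> : (t %% 3 == 1) = false by lia.
have [jm|jm] := eqVneq j m.
  rewrite (stage_passive Xt tv jd pj) /receive.
  have -> : j.+1 < d by lia.
  have -> : 0 < j by lia.
  have -> : (d <= t.+1) && (j.+1 + t == 2 * d.-1) by lia.
  have -> : (j == t.+1) = false by lia.
  by have -> : (j == (t %/ 3).+1) && (t %% 3 == 2) by lia.
have nR : (d <= t.+1) && (j.+1 + t == 2 * d.-1) = false by lia.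
have nL : (j == t.+1) = false by lia.
have nL' : (j == (t %/ 3).+1) && (t %% 3 == 2) = false by lia.
by rewrite (stage_passive_next Xt tv jd pj) nR ?nL ?nL' !if_same.
Qed.

Lemma calm_stage t j : ~~ is_fire (stage d u t j, w j) /\ ~~ is_pre (stage d u t j, w j).
Proof.
by rewrite /stage; do !case: ifP => // _.
Qed.

End Stage.

(** * Recursive halving of a segment *)

Section Sync.
Variable l : seq pos.
Let X := slow_state l.

Definition started (c : nat -> nat) d (w : nat -> walls) t0 := forall j, j < d ->
  X t0 (c j) = (if j == 0 then Gen else Quiet, w j).

(** The [Pre] times of the end cells are recorded because a [Dead] cell next to an end fires on
    hearing them: cell 0 serves the split that created the segment, the last cell the enclosing
    ones. *)
Definition synced (c : nat -> nat) d t0 T :=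
  [/\ forall t j, t < T -> j < d -> ~~ is_fire (X (t0 + t) (c j)),
      forall j, j < d -> is_fire (X (t0 + T) (c j)),
      forall t, t < T -> is_pre (X (t0 + t) (c 0)) = (t.+1 == T) &
      forall t, t < T -> is_pre (X (t0 + t) (c d.-1)) = (t.+1 == T)].

(** Common to both parities: between the halves there is the single [Dead] cell or nothing. The ends
    of the whole segment are the last cells of the halves, both read outwards from the middle. *)
Lemma synced_join c d m t0 s T : 0 < m -> m + m <= d -> 0 < T ->
  (forall t j, t < s -> j < d -> ~~ is_fire (X (t0 + t) (c j)) /\ ~~ is_pre (X (t0 + t) (c j))) ->
  synced (fun j => c (m.-1 - j)) m (t0 + s) T ->
  synced (fun j => c (d - m + j)) m (t0 + s) T ->
  (forall j, m <= j < d - m -> (forall t, t < T -> ~~ is_fire (X (t0 + s + t) (c j))) /\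
     is_fire (X (t0 + s + T) (c j))) ->
  synced c d t0 (s + T).
Proof.
move=> m0 md T0 calm [L1 L2 _ L4] [R1 R2 _ R4] M.
have late t j : t < T -> j < d -> ~~ is_fire (X (t0 + s + t) (c j)).
  move=> tT jd; have [jm|mj] := ltnP j m.
    by have := L1 t (m.-1 - j) tT; rewrite subKn; [apply; lia | lia].
  have [jm|jm] := ltnP j (d - m); first by have [] := M j ltac:(lia) => /(_ t tT).
  by have := R1 t (j - (d - m)) tT; rewrite subnKC //; apply; lia.
have lateP c' t : (forall t, t < T -> is_pre (X (t0 + s + t) (c c')) = (t.+1 == T)) -> c' < d ->
    t < s + T -> is_pre (X (t0 + t) (c c')) = (t.+1 == s + T).
  move=> H cd tT; have [ts|st] := ltnP t s.
    have [_ /negbTE->] := calm t c' ts cd; apply/esym/negbTE; rewrite neq_ltn; apply/orP; left.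
    by lia.
  have := H (t - s); rewrite -addnA subnKC // => -> //; lia.
split.
- move=> t j tT jd; have [ts|st] := ltnP t s; first by case: (calm t j ts jd).
  by have := late (t - s) j; rewrite -addnA subnKC //; apply; lia.
- move=> j jd; rewrite addnA; have [jm|mj] := ltnP j m.
    by have := L2 (m.-1 - j); rewrite subKn; [apply; lia | lia].
  have [jm|jm] := ltnP j (d - m); first by have [] := M j ltac:(lia).
  by have := R2 (j - (d - m)); rewrite subnKC //; apply; lia.
- by move=> t; apply: lateP; [move=> t' t'T; have := L4 _ t'T; rewrite subnn | lia].
- move=> t; apply: lateP; [move=> t' t'T; have := R4 _ t'T| lia].
  by have -> : d - m + m.-1 = d.-1 by lia.
Qed.

Section Split.
Variables (d : nat) (c : nat -> nat) (u : nat -> 'I_4) (w : nat -> walls) (t0 m : nat).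
Hypotheses (ch : chain l d c u w) (st : started c d w t0) (m0 : 0 < m).

Let stage_start j : j < d -> slow_state l (t0 + 0) (c j) = (if j == 0 then Gen else Quiet, w j).
Proof. by rewrite addn0; apply: st. Qed.

Lemma quiet_next t (y : nat -> kind) j : (forall i, i < d -> X t (c i) = (y i, w i)) ->
  j < d -> y j = Quiet ->
  let mR := if j.+1 < d then send (y j.+1) (turn (u j)) else mNone in
  let mL := if 0 < j then send (y j.-1) (u j.-1) else mNone in
  [/\ mR = mNone -> mL = mNone -> X t.+1 (c j) = (Quiet, w j),
      mR = mMid -> mL = mNone -> X t.+1 (c j) = (Gen, add_wall (w j) (u j)) &
      mL = mMid -> mR = mNone -> X t.+1 (c j) = (Gen, add_wall (w j) (turn (u j.-1)))].
Proof.
move=> Xy jd yj mR mL.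
have ER : (if j.+1 < d then send (run slow l t (nth origin l (c j.+1))).1 (turn (u j)) else mNone) = mR.
  by rewrite /mR; case: ltnP => // jd1; have := Xy _ jd1; rewrite /X /slow_state => ->.
have EL : (if 0 < j then send (run slow l t (nth origin l (c j.-1))).1 (u j.-1) else mNone) = mL.
  rewrite /mL; case: ltnP => // j0; have jd1 : j.-1 < d by lia.
  by have := Xy _ jd1; rewrite /X /slow_state => ->.
have Xj := Xy _ jd; rewrite yj in Xj.
have := step_passive ch jd Xj isT; rewrite ER EL -/(slow_state _ _ _) -/(X _ _) => N.
split=> E E'.
- by rewrite N E E'.
- rewrite N E E' //; move: E; rewrite /mR; case: ltnP => // jd1 _; by rewrite /receive.
- rewrite N ?E ?E' //; move: E; rewrite /mL; case: ltnP => // j0 _; by rewrite /receive.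
Qed.

Lemma split_odd j : d = (2 * m).+1 -> j < d -> X (t0 + (3 * m).+1) (c j) =
  (if j == m then Dead else if (j == m.-1) || (j == m.+1) then Gen else Quiet,
   if j == m.-1 then add_wall (w j) (u j) else
   if j == m.+1 then add_wall (w j) (turn (u m)) else w j).
Proof.
move=> dm jd; have X3 := stage_odd ch stage_start dm m0; rewrite addnS.
have [jm|jm] := eqVneq j m.
  have := X3 _ jd; rewrite jm eqxx => Xj.
  rewrite /X /slow_state (step_mid ch _ Xj) // -?jm // .
  have -> : (j == j.-1) = false by lia.
  by have -> : (j == j.+1) = false by lia.
have [] := @quiet_next _ (fun j => if j == m then Mid else Quiet) j X3 jd; first by rewrite (negbTE jm).
have [j1|j1] := eqVneq j m.-1.
  move=> _ + _; apply.
    have -> : j.+1 < d by lia.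
    by have -> : j.+1 == m by lia.
  case: ltnP => // j0.
  by have -> : (j.-1 == m) = false by lia.
have [j2|j2] := eqVneq j m.+1.
  move=> _ _; rewrite j2 /= eqxx; apply => //.
  case: ltnP => // j0.
  by have -> : (m.+2 == m) = false by lia.
move=> + _ _; apply.
  have -> : (j.+1 == m) = false by lia.
  by rewrite if_same.
case: ltnP => // j0.
by have -> : (j.-1 == m) = false by lia.
Qed.

Lemma split_even j : d = 2 * m -> j < d -> X (t0 + 3 * m) (c j) =
  (if (j == m.-1) || (j == m) then Gen else Quiet,
   if j == m.-1 then add_wall (w j) (u j) else
   if j == m then add_wall (w j) (turn (u m.-1)) else w j).
Proof.
move=> dm jd; have X3 := stage_even ch stage_start dm m0.
have -> : t0 + 3 * m = (t0 + (3 * m - 1)).+1 by lia.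
have [jm|jm] := eqVneq j m.-1.
  have := X3 _ jd; rewrite jm eqxx => Xj.
  by rewrite /X /slow_state (step_midE ch _ Xj erefl) // -jm.
have [] := @quiet_next _ (fun j => if j == m.-1 then MidE (u j) else Quiet) j X3 jd.
  by rewrite (negbTE jm).
have [j2|j2] := eqVneq j m.
  move=> _ _; rewrite -j2; apply.
    have -> : 0 < j by lia.
    by rewrite !eqxx /= eqxx.
  have -> : (j.+1 == j.-1) = false by lia.
  by rewrite if_same.
move=> + _ _; apply.
  case: ltnP => // jd1; case: eqP => //= jE.
  have jd2 : j.+2 < d by lia.
  by have /negbTE := chain_turn ch jd2; rewrite eq_sym => ->.
case: ltnP => // j0.
by have -> : (j.-1 == m.-1) = false by lia.
Qed.

Lemma calm_before t j : (0 < t -> t + t %/ 3 < 2 * d.-1) -> j < d ->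
  ~~ is_fire (X (t0 + t) (c j)) /\ ~~ is_pre (X (t0 + t) (c j)).
Proof.
move=> tv jd; have := stage_run ch stage_start tv jd; rewrite -/X => ->.
exact: calm_stage.
Qed.

End Split.

Lemma send_pre x e : (send x.1 e == mPre) = is_pre x.
Proof. by case: x => -[] *; rewrite /is_pre //=; case: ifP. Qed.

Lemma dead_fires d c u w j t0 T : chain l d c u w -> 0 < j -> j.+1 < d -> 0 < T ->
  X t0 (c j) = (Dead, w j) ->
  (forall t, t < T -> is_pre (X (t0 + t) (c j.-1)) = (t.+1 == T)) ->
  (forall t, t < T -> is_pre (X (t0 + t) (c j.+1)) = (t.+1 == T)) ->
  (forall t, t < T -> ~~ is_fire (X (t0 + t) (c j))) /\ is_fire (X (t0 + T) (c j)).
Proof.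
move=> ch j0 jd T0 X0 PL PR; have jd' : j < d by lia.
have step t : t < T -> X (t0 + t) (c j) = (Dead, w j) ->
    X (t0 + t.+1) (c j) = (if t.+1 == T then Fire else Dead, w j).
  move=> tT Xt; rewrite addnS /X /slow_state (step_dead ch jd' Xt erefl).
  by rewrite jd j0 !send_pre PL // PR // orbb.
have dead t : t < T -> X (t0 + t) (c j) = (Dead, w j).
  elim: t => [|t IH] tT; first by rewrite addn0.
  by rewrite step ?IH ?(ltnW tT) // ltn_eqF.
split=> [t tT|]; first by rewrite dead.
have := @step T.-1; rewrite prednK // eqxx => ->; rewrite ?dead //; lia.
Qed.

(** It is essential that [T] is chosen before the position, the walls and the starting time: two
    halves of equal size started together then finish together. *)
Lemma sync_segment d : 0 < d -> exists2 T, 0 < T & forall c u w t0,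
  chain l d c u w -> started c d w t0 -> synced c d t0 T.
Proof.
elim/ltn_ind: d => d IH d0; have [d1|d1] := eqVneq d 1.
  subst d; exists 2 => // c u w t0 ch st.
  have X0 := st 0 isT.
  have X1 : X t0.+1 (c 0) = (Pre, w 0) by rewrite /X /slow_state (step_gen ch _ X0).
  have X2 : X t0.+2 (c 0) = (Fire, w 0) by rewrite /X /slow_state (step_pre ch _ X1).
  split; [| |move=> t | move=> t].
  - by move=> [|[|//]] [|//] _ _; rewrite ?addn0 ?addn1 ?X0 ?X1.
  - by move=> [|//] _; rewrite addn2 X2.
  - by case: t => [|[|//]] _; rewrite ?addn0 ?addn1 ?X0 ?X1.
  - by case: t => [|[|//]] _; rewrite ?addn0 ?addn1 ?X0 ?X1.
pose m := d./2; have m0 : 0 < m by lia.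
have md : 0 < m < d by lia.
have [T T0 HT] : exists2 T, 0 < T & forall c u w t0,
    chain l m c u w -> started c m w t0 -> synced c m t0 T.
  by apply: IH => //; lia.
have [odd_d|even_d] := boolP (odd d).
  have dm : d = (2 * m).+1 by lia.
  exists ((3 * m).+1 + T) => [|c u w t0 ch st]; first by lia.
  have S j := split_odd ch st m0 (j := j) dm.
  have left : synced (fun j => c (m.-1 - j)) m (t0 + (3 * m).+1) T.
    apply: (HT _ _ _ _ (chain_rev (chain_take ch md))) => j jm /=; rewrite S; last by lia.
    have -> : (m.-1 - j == m) = false by lia.
    have -> : (m.-1 - j == m.+1) = false by lia.
    have -> : (m.-1 - j == m.-1) = (j == 0) by lia.
    by rewrite orbF.
  have right : synced (fun j => c (m.+1 + j)) m (t0 + (3 * m).+1) T.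
    have md1 : 0 < m.+1 < d by lia.
    have := chain_drop ch md1; have -> : d - m.+1 = m by lia.
    move=> chm; apply: (HT _ _ _ _ chm) => j jm; rewrite S; last by lia.
    have -> : (m.+1 + j == m) = false by lia.
    have -> : (m.+1 + j == m.+1) = (j == 0) by lia.
    have -> : (m.+1 + j == m.-1) = false by lia.
    by case: eqP => //= ->; rewrite addn0.
  apply: (synced_join (m := m)) => //; first by lia.
  (* At time 3m the signals have just met and [stage] no longer describes the cells; all earlier
     times satisfy its bound. *)
  - move=> t j tm jd; have [->|t3] := eqVneq t (3 * m).
      have st0 i : i < d -> slow_state l (t0 + 0) (c i) = (if i == 0 then Gen else Quiet, w i).
        by rewrite addn0; apply: st.
      by rewrite /X (stage_odd ch st0 dm m0) //; case: (j == m).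
    have tv : 0 < t -> t + t %/ 3 < 2 * d.-1 by lia.
    exact: (calm_before ch st tv jd).
  - by have -> : d - m = m.+1 by lia.
  - move=> j jm; have {jm} -> : j = m by lia.
    case: left right => _ _ PL _ [_ _ PR _].
    apply: (dead_fires ch m0) => //; first by lia.
    + rewrite S; last by lia.
      rewrite eqxx; have -> : (m == m.-1) = false by lia.
      by have -> : (m == m.+1) = false by lia.
    + by move=> t /PL; rewrite subn0.
    + by move=> t /PR; rewrite addn0.
have dm : d = 2 * m by lia.
exists (3 * m + T) => [|c u w t0 ch st]; first by lia.
have S j := split_even ch st m0 (j := j) dm.
apply: (synced_join (m := m)) => //; first by lia.
- move=> t j tm jd; have [->|t3] := eqVneq t (3 * m - 1).
    have st0 i : i < d -> slow_state l (t0 + 0) (c i) = (if i == 0 then Gen else Quiet, w i).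
        by rewrite addn0; apply: st.
      by rewrite /X (stage_even ch st0 dm m0) //; case: (j == m.-1).
  have tv : 0 < t -> t + t %/ 3 < 2 * d.-1 by lia.
    exact: (calm_before ch st tv jd).
- apply: (HT _ _ _ _ (chain_rev (chain_take ch md))) => j jm /=; rewrite S; last by lia.
  have -> : (m.-1 - j == m) = false by lia.
  have -> : (m.-1 - j == m.-1) = (j == 0) by lia.
  by rewrite orbF.
- have E : d - m = m by lia.
  have := chain_drop ch md; rewrite E => chm; apply: (HT _ _ _ _ chm) => j jm; rewrite S; last by lia.
  have -> : (m + j == m) = (j == 0) by lia.
  have -> : (m + j == m.-1) = false by lia.
  by case: eqP => //= ->; rewrite addn0.
- by move=> j; lia.
Qed.

End Sync.

(** * The whole path as one segment, and the search for an end *)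

Definition forward (l : seq pos) (j : nat) : 'I_4 :=
  odflt ord0 [pick e | nbr l j e == Some j.+1].

Lemma chain_line l k : is_config l k ->
  chain l (size l) id (forward l) (fun=> no_walls).
Proof.
move=> cl; have fwd j : j.+1 < size l -> nbr l j (forward l j) = Some j.+1.
  move=> jl; have [e Ee] := nbr_next cl jl; rewrite /forward.
  by case: pickP => [f /eqP//|/(_ e)]; rewrite Ee eqxx.
have bwd j : j.+1 < size l -> nbr l j.+1 (turn (forward l j)) = Some j.
  by move=> jl; apply: (nbr_turn cl) => //; [apply: ltnW | apply: fwd].
split=> //.
- move=> j jl; apply/eqP => E.
  have := fwd j.+1 jl; rewrite E bwd; last exact: ltnW.
  by case; lia.
- move=> j e jl; rewrite ffunE /=; apply/idP/orP.
    case E: (nbr l j e) => [i|] // _; have [il _] := nbr_padd E.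
    have [ij|ji] := nbr_consec cl jl E; [left | right]; apply/andP; subst.
      by split=> //; apply/eqP; apply: nbr_inj E; apply: fwd.
    by split=> //=; apply/eqP; apply: nbr_inj E; apply: bwd.
  case=> /andP[j1 /eqP <-]; first by rewrite fwd.
  by have := @bwd j.-1; rewrite prednK // => ->.
Qed.

Section Seek.
Variables (l : seq pos) (d k : nat) (c : nat -> nat) (u : nat -> 'I_4) (w : nat -> walls).
Hypothesis ch : chain l d c u w.
Let X := slow_state l.
Let seeker p := if p == 0 then Gen else Seek (turn (u p.-1)).
Hypotheses (kd : k < d)
  (X0 : forall j, j < d -> X 0 (c j) = (if j == k then seeker k else Quiet, w j)).

Lemma seek_run t : t <= k -> forall j, j < d ->
  X t (c j) = (if j == k - t then seeker (k - t) else Quiet, w j).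
Proof.
elim: t => [|t IH] tk j jd; first by rewrite subn0; apply: X0.
have {}IH := IH (ltnW tk); have IHl i := IH i; rewrite /X /slow_state in IHl.
set p := k - t in IH IHl; have p0 : 0 < p by lia.
have sp : seeker p = Seek (turn (u p.-1)) by rewrite /seeker gtn_eqF.
have pj : passive (if j == p then seeker p else Quiet) by rewrite sp; case: ifP.
have tuF : p.+1 < d -> (u p == turn (u p.-1)) = false.
  by have := chain_turn ch (j := p.-1); rewrite prednK // => H /H/negbTE.
have ER : (if j.+1 < d then send (X t (c j.+1)).1 (turn (u j)) else mNone) =
    if j.+1 == p then mSeek else mNone.
  case: ltnP => jd1; last by have -> : (j.+1 == p) = false by lia.
  rewrite IH //=; case: eqP => [jp|_] //.
  by rewrite sp -jp /= eqxx.
have EL : (if 0 < j then send (X t (c j.-1)).1 (u j.-1) else mNone) = mNone.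
  case: ltnP => // j0; have jd1 : j.-1 < d by lia.
  rewrite IH //=; case: eqP => [jp|_] //.
  by rewrite sp jp /= tuF //; lia.
rewrite /X /slow_state in ER EL.
rewrite {1}/X /slow_state (step_passive ch jd (IHl j jd) pj) ER EL; last by case: ifP.
have -> : k - t.+1 = p.-1 by lia.
have [jp|jp] := eqVneq j p.-1; last first.
  by have -> : (j.+1 == p) = false by lia.
have -> : j.+1 == p by lia.
have jd1 : j.+1 < d by lia.
rewrite jd1 /receive /= eqxx -jp /seeker.
by case: posnP => // ->.
Qed.

Lemma seek_calm t j : t <= k -> j < d -> ~~ is_fire (X t (c j)).
Proof.
by move=> tk jd; rewrite seek_run // /seeker; do !case: ifP.
Qed.

Lemma seek_started : started l c d w k.
Proof.
by move=> j jd; rewrite -[slow_state l]/X seek_run // subnn.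
Qed.

End Seek.

(** Which way the general sends the token depends on the numbering of the ports. The cells are
    numbered so that it heads for cell 0: in reversed order if the chosen port leads to index k +
    1. *)
Lemma slow_solution : solution slow.
Proof.
move=> l k cl; have kl : k < size l by case: cl.
have [c [u [k' [ch sur k'l X0]]]] : exists c u k',
  [/\ chain l (size l) c u (fun=> no_walls), forall i, i < size l -> exists2 j, j < size l & c j = i,
      k' < size l &
      forall j, j < size l -> slow_state l 0 (c j) =
        (if j == k' then (if k' == 0 then Gen else Seek (turn (u k'.-1))) else Quiet, no_walls)].
  have ch := chain_line cl.
  have X0 i : i < size l -> slow_state l 0 i =
      if i == k then sgen (bc l origin) else (Quiet, no_walls).
    move=> il; rewrite /slow_state /= (origin_index cl) // enum_rankK.
    by case: eqP => // ->; case: cl => _ -> _ _ _.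
  have orig : nth origin l k = origin by case: cl.
  rewrite /sgen in X0; case: pickP X0 => [e be|nb] X0.
    have /(nthP origin)[i il Ei] : padd (nth origin l k) (eps e) \in l.
      by rewrite orig; move: be; rewrite ffunE.
    have Ni : nbr l k e = Some i by apply: (nbr_of_padd cl).
    have [ik|ki] := nbr_consec cl kl Ni.
      have k1l : k.+1 < size l by rewrite -ik.
      exists (fun j => (size l).-1 - j), (fun j => turn (forward l ((size l).-2 - j))), ((size l).-1 - k).
      split; [exact: (chain_rev ch) | | by lia |].
        by move=> j jl; exists ((size l).-1 - j); rewrite /=; lia.
      move=> j jl; rewrite X0; last by lia.
      have -> : ((size l).-1 - j == k) = (j == (size l).-1 - k) by lia.
      case: eqP => // _; have -> : ((size l).-1 - k == 0) = false by lia.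
      rewrite turnK; congr (Seek _, _).
      have -> : (size l).-2 - ((size l).-1 - k).-1 = k by lia.
      apply: nbr_inj Ni _; rewrite ik; apply: (chain_fwd ch); lia.
    exists id, (forward l), k; split=> //; first by move=> j jl; exists j.
    move=> j jl; rewrite X0 //; case: eqP => // _.
    have -> : (k == 0) = false by lia.
    congr (Seek _, _); apply: nbr_inj Ni _.
    by rewrite ki; apply: (chain_bwd ch); lia.
  have n1 : size l = 1.
    have := chain_open ch; have := kl; case: (ltnP k.+1 (size l)) => [k1 _ _|].
      have := nb (forward l k); rewrite ffunE -orig -nbr_mem.
      by rewrite (chain_fwd ch k1).
    case: (posnP k) => [->|k0 _ _ _]; first by lia.
    have := nb (turn (forward l k.-1)); rewrite ffunE -orig -nbr_mem.
    by have := chain_bwd ch (j := k.-1); rewrite prednK // => /(_ kl) ->.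
  have k0 : k = 0 by lia.
  exists id, (forward l), 0; split=> //; [by move=> j jl; exists j | by rewrite n1 |].
  by move=> j jl; rewrite X0 // k0; case: eqP.
have n0 : 0 < size l by lia.
have [T T0 HT] := sync_segment l n0.
have [F1 F2 _ _] := HT _ _ _ _ ch (seek_started ch k'l X0).
exists (k' + T); split=> [t tT p /(nthP origin)[i il <-]|p /(nthP origin)[i il <-]];
  have [j jl <-] := sur i il; last exact: F2.
have [tk|kt] := leqP t k'; first exact: (seek_calm ch k'l X0).
have := F1 (t - k') j; rewrite subnKC; last exact: ltnW.
by apply=> //; lia.
Qed.

(** * The timer for given arm lengths *)

Section Exact.
Variables a b : nat.
Let T := a + b + maxn a b.

Definition clock := 'I_(a + b + maxn a b).+2.
(* Clocks saturate one step after the firing time [T]. *)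
Definition sat (t : nat) : clock := inord (minn t T.+1).

Definition awake : finType := (clock * {set clock} * {ffun 'I_4 -> option {set clock}})%type.

(* A node stores, for each direction, the length of the arm of the general that ends in
   that direction, as the singleton of the time at which this end woke up, or the empty
   set if there is no node in that direction; [None] stands for not yet known.  The
   component [own] plays the same role for an arm ending at the node itself. *)
Definition tell (s : awake) (e : 'I_4) : option {set clock} :=
  let: (_, own, info) := s in
  if [forall f, (f != e) ==> isSome (info f)]
  then Some (own :|: \bigcup_(f | f != e) odflt set0 (info f)) else None.

Definition hear (nb : {ffun 'I_4 -> option (option awake)}) : {ffun 'I_4 -> option {set clock}} :=
  [ffun e => match nb e with
             | None => Some set0
             | Some None => None
             | Some (Some s) => tell s (turn e)
             end].

Definition clock_of (x : option (option awake)) : option clock :=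
  if x is Some (Some (c, _, _)) then Some c else None.

(** At most one neighbour means an end of the path, and an end wakes up at a time equal to the
    length of its arm. A path of one node is both ends at once; both lengths are then 0 and one
    singleton suffices. *)
Definition own_info (c : clock) (P : pred 'I_4) : {set clock} :=
  if #|P| <= 1 then [set c] else set0.

(** A sleeping node takes over the clock of an awake neighbour, so every clock shows the global
    time, up to saturation. *)
Definition edelta (s : option awake) (nb : {ffun 'I_4 -> option (option awake)}) : option awake :=
  if s is Some (c, own, _) then Some (sat c.+1, own, hear nb)
  else if [pick c | [exists e, clock_of (nb e) == Some c]] is Some c then
    Some (sat c.+1, own_info (sat c.+1) [pred e | isSome (nb e)], hear nb)
  else None.

Definition egen (m : {ffun 'I_4 -> bool}) : option awake :=
  Some (sat 0, own_info (sat 0) [pred e | m e], [ffun e => if m e then None else Some set0]).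

(** Without a common orientation only the set of the two lengths can be compared with the prescribed
    ones. *)
Definition efire (s : option awake) : bool :=
  if s is Some (c, own, info) then
    [&& c == sat T, [forall e, isSome (info e)] &
        own :|: \bigcup_e odflt set0 (info e) == [set sat a; sat b]]
  else false.

Lemma edelta_asleep (nb : {ffun 'I_4 -> option (option awake)}) :
  (forall e, nb e = None \/ nb e = Some None) -> edelta None nb = None.
Proof.
move=> H; rewrite /edelta pick_none // => c; apply/existsP => -[e].
by case: (H e) => ->.
Qed.

Definition exact_timer : automaton :=
  @Automaton (option awake) None #|{ffun 'I_4 -> bool}| (fun i => egen (enum_val i)) efire
    enum_rank edelta isT edelta_asleep.

Lemma val_sat t : sat t = minn t T.+1 :> nat.
Proof. by rewrite inordK // ltnS geq_minr. Qed.

Lemma satS t : sat (sat t).+1 = sat t.+1.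
Proof. by apply: val_inj; rewrite /= !val_sat; lia. Qed.

Lemma tell_end (c : clock) own (info : {ffun 'I_4 -> option {set clock}}) e : (forall f, f != e -> info f = Some set0) ->
  tell (c, own, info) e = Some own.
Proof.
move=> H; rewrite /tell ifT; last by apply/forallP => f; apply/implyP => /H->.
by rewrite big1 ?setU0 // => f /H->.
Qed.

Lemma tell_mid (c : clock) own (info : {ffun 'I_4 -> option {set clock}}) e o : o != e ->
  (forall f, f != e -> f != o -> info f = Some set0) ->
  tell (c, own, info) e = omap (fun A => own :|: A) (info o).
Proof.
move=> oe H; rewrite /tell; case Eo : (info o) => [A|] /=.
  rewrite ifT; last by apply/forallP => f; apply/implyP => fe; have [->|fo] := eqVneq f o; rewrite ?Eo ?H.
  by rewrite (bigD1 o) //= Eo big1 ?setU0 // => f /andP[fe fo]; rewrite H.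
by rewrite ifF //; apply/forallP => /(_ o); rewrite oe Eo.
Qed.

(** * The run of the timer on a configuration *)

Section Run.
Variables (l : seq pos) (k : nat).
Hypothesis cl : is_config l k.
Let n := size l.
Let k' := n.-1 - k.

Let kn : k < n. Proof. by case: cl. Qed.

(** The left end wakes up at time k and its message needs i steps, hence the threshold k + i; the
    right arm is symmetric, with [k'] = s. *)
Definition arm_info (t i : nat) : {ffun 'I_4 -> option {set clock}} :=
  [ffun e => if nbr l i e is Some j then
      if j < i then (if k + i <= t then Some [set sat k] else None)
      else (if k' + (n.-1 - i) <= t then Some [set sat k'] else None)
    else Some set0].

Definition end_info (i : nat) : {set clock} :=
  (if i == 0 then [set sat k] else set0) :|: (if i == n.-1 then [set sat k'] else set0).

Definition timer_state (t i : nat) : option awake :=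
  if t < i - k + (k - i) then None else Some (sat t, end_info i, arm_info t i).

Lemma tell_right t j e : j.+1 < n -> nbr l j e = Some j.+1 -> j - k + (k - j) <= t ->
  tell (sat t, end_info j, arm_info t j) e = if k + j <= t then Some [set sat k] else None.
Proof.
move=> jn Ee jt; have jn' : j < n by apply: ltnW.
have [j0|j0] := posnP j.
  rewrite tell_end.
    rewrite j0 /end_info eqxx; have -> : (0 == n.-1) = false by lia.
    by rewrite setU0; have -> : k + 0 <= t by lia.
  move=> f fe; rewrite ffunE; case Ef: (nbr l j f) => [i|] //.
  have [ij|ji] := nbr_consec cl jn' Ef; last by lia.
  by case/eqP: fe; apply: nbr_inj Ef _; rewrite Ee ij.
have [o Eo] : exists o, nbr l j o = Some j.-1.
  by have := @nbr_prev _ _ cl j.-1; rewrite prednK //; apply.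
rewrite (@tell_mid _ _ _ _ o).
- rewrite ffunE Eo prednK // leqnn; case: ifP => //= _.
  rewrite /end_info (gtn_eqF j0); have -> : (j == n.-1) = false by lia.
  by rewrite !set0U.
- by apply/eqP => oe; rewrite oe Ee in Eo; case: Eo; lia.
- move=> f fe fo; rewrite ffunE; case Ef: (nbr l j f) => [i|] //.
  have [ij|ji] := nbr_consec cl jn' Ef.
    by case/eqP: fe; apply: nbr_inj Ef _; rewrite Ee ij.
  by case/eqP: fo; apply: nbr_inj Ef _; rewrite Eo ji.
Qed.

Lemma tell_left t j e : 0 < j -> j < n -> nbr l j e = Some j.-1 -> j - k + (k - j) <= t ->
  tell (sat t, end_info j, arm_info t j) e =
  if k' + (n.-1 - j) <= t then Some [set sat k'] else None.
Proof.
move=> j0 jn Ee jt.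
have [jl|jl] := eqVneq j n.-1.
  rewrite tell_end.
    rewrite /end_info (gtn_eqF j0) -jl eqxx set0U.
    by have -> : k' + (j - j) <= t by lia.
  move=> f fe; rewrite ffunE; case Ef: (nbr l j f) => [i|] //.
  have [il _] := nbr_padd Ef.
  have [ij|ji] := nbr_consec cl jn Ef; first by move: il; rewrite ij jl -/n; lia.
  by case/eqP: fe; apply: nbr_inj Ef _; rewrite Ee ji.
have jn1 : j.+1 < n by lia.
have [o Eo] := nbr_next cl jn1.
rewrite (@tell_mid _ _ _ _ o).
- rewrite ffunE Eo ltnNge leqnSn /=; case: ifP => //= _.
  by rewrite /end_info (gtn_eqF j0) (negbTE jl) !set0U.
- by apply/eqP => oe; rewrite oe Ee in Eo; case: Eo; lia.
- move=> f fe fo; rewrite ffunE; case Ef: (nbr l j f) => [i|] //.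
  have [ij|ji] := nbr_consec cl jn Ef.
    by case/eqP: fo; apply: nbr_inj Ef _; rewrite Eo ij.
  by case/eqP: fe; apply: nbr_inj Ef _; rewrite Ee ji.
Qed.

Lemma hear_step t i : i < n ->
  hear [ffun e => omap (timer_state t) (nbr l i e)] = arm_info t.+1 i.
Proof.
move=> il; apply/ffunP => e; rewrite !ffunE; case Ee: (nbr l i e) => [j|] //=.
have [jl _] := nbr_padd Ee; have Ej := nbr_turn cl il Ee.
rewrite /timer_state; case: (nbr_consec cl il Ee) => ij.
  have -> : (j < i) = false by lia.
  case: ltnP => jt; first by have -> : (k' + (n.-1 - i) <= t.+1) = false by lia.
  subst j; rewrite tell_left //.
  have -> // : (k' + (n.-1 - i.+1) <= t) = (k' + (n.-1 - i) <= t.+1).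
  by rewrite /n in jl *; lia.
have -> : j < i by lia.
case: ltnP => jt; first by have -> : (k + i <= t.+1) = false by lia.
rewrite tell_right -?ij //.
by have -> : (k + j <= t) = (k + i <= t.+1) by lia.
Qed.

Lemma card_nbr i : i < n -> (#|[pred e | isSome (nbr l i e)]| <= 1) = (i == 0) || (i == n.-1).
Proof.
move=> il; apply/idP/idP => [|H].
  apply: contraLR; rewrite negb_or -ltnNge => /andP[i0 i1].
  have il1 : i.+1 < n by lia.
  have [e Ee] := nbr_next cl il1.
  have [f Ef] : exists f, nbr l i f = Some i.-1.
    by have := @nbr_prev _ _ cl i.-1; rewrite prednK ?lt0n //; apply.
  apply/card_gt1P; exists e, f; rewrite !inE Ee Ef; split=> //.
  by apply/eqP => ef; rewrite ef Ef in Ee; case: Ee; lia.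
apply/card_le1_eqP => e f; rewrite !inE.
case Ee: (nbr l i e) => [j|] // _; case Ef: (nbr l i f) => [j'|] // _.
have [jl _] := nbr_padd Ee; have [jl' _] := nbr_padd Ef.
suff jj : j = j' by apply: (nbr_inj Ef); rewrite -jj.
have := nbr_consec cl il Ee; have := nbr_consec cl il Ef; rewrite /n in H il; lia.
Qed.

Lemma own_info_end i (P : pred 'I_4) : i < n -> P =1 (fun e => isSome (nbr l i e)) ->
  own_info (sat (i - k + (k - i))) P = end_info i.
Proof.
move=> il PE; rewrite /own_info (eq_card (B := [pred e | isSome (nbr l i e)])); last by move=> e; rewrite !inE -PE.
rewrite card_nbr // /end_info.
have [i0|i0] := eqVneq i 0; have [i1|i1] := eqVneq i n.-1 => /=; rewrite ?setU0 ?set0U //.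
- have -> : k = 0 by lia.
  have -> : k' = 0 by rewrite /k' -i1 i0.
  by rewrite i0 setUid.
- by rewrite i0; congr [set sat _]; lia.
- by congr [set sat _]; rewrite /k'; lia.
Qed.

Lemma timer_run t i : i < n -> run exact_timer l t (nth origin l i) = timer_state t i.
Proof.
elim: t i => [|t IH] i il.
  rewrite /= (origin_index cl) //; case: eqP => [->|ik]; last first.
    by rewrite /timer_state; have -> : 0 < i - k + (k - i) by lia.
  rewrite /timer_state subnn ltnn enum_rankK; congr Some; congr ((_, _), _).
    have := @own_info_end k [pred e | bc l (nth origin l k) e] kn; rewrite subnn; apply.
    by move=> e; rewrite /= ffunE nbr_mem.
  apply/ffunP => e; rewrite !ffunE -nbr_mem; case Ee: (nbr l k e) => [j|] //=.
  have [jl _] := nbr_padd Ee; have [jk|kj] := nbr_consec cl kn Ee.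
    have -> : (j < k) = false by lia.
    by have -> : (k' + (n.-1 - k) <= 0) = false by rewrite /k' /n; rewrite jk in jl; lia.
  have -> : j < k by lia.
  by have -> : (k + k <= 0) = false by lia.
have -> : run exact_timer l t.+1 (nth origin l i) =
    edelta (timer_state t i) [ffun e => omap (timer_state t) (nbr l i e)].
  rewrite run_nbr // IH //; congr edelta; apply/ffunP => e; rewrite !ffunE.
  by case Ee: (nbr l i e) => [j|] //=; rewrite IH //; case: (nbr_padd Ee).
rewrite {1}/timer_state; case: ltnP => it; last first.
  rewrite /= satS hear_step // /timer_state.
  by have -> : (t.+1 < i - k + (k - i)) = false by lia.
have clockE e : clock_of ([ffun e => omap (timer_state t) (nbr l i e)] e) =
    if nbr l i e is Some j then if t < j - k + (k - j) then None else Some (sat t) else None.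
  by rewrite ffunE; case: (nbr l i e) => [j|] //=; rewrite /timer_state; case: ifP.
have [it1|it1] := ltnP t.+1 (i - k + (k - i)).
  rewrite /edelta pick_none; first by rewrite /timer_state it1.
  move=> c; apply/existsP => -[e]; rewrite clockE; case Ee: (nbr l i e) => [j|] //.
  have := nbr_consec cl il Ee => ij.
  by have -> : t < j - k + (k - j) by lia.
have {}it : i - k + (k - i) = t.+1 by lia.
(* The neighbour one step nearer to the general woke up exactly at time t and supplies the clock. *)
have [e [j [Ee jt]]] : exists e j, nbr l i e = Some j /\ j - k + (k - j) = t.
  have [ik|ki] := ltnP i k.
    have i1 : i.+1 < n by lia.
    by have [e Ee] := nbr_next cl i1; exists e, i.+1; split=> //; lia.
  have [e Ee] : exists e, nbr l i e = Some i.-1.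
    by have := @nbr_prev _ _ cl i.-1; rewrite prednK; [apply | lia].
  by exists e, i.-1; split=> //; lia.
rewrite /edelta (pick_some (x := sat t)); first last.
- move=> c /existsP[f]; rewrite clockE; case: (nbr l i f) => [j'|] //; case: ifP => // _ /eqP[]//.
- by apply/existsP; exists e; rewrite clockE Ee jt ltnn.
rewrite satS hear_step // -it own_info_end //; last first.
  by move=> f; rewrite /= ffunE; case: (nbr l i f).
by rewrite it /timer_state it ltnn.
Qed.

(** Node i knows both lengths from time max(k + i, k' + (n-1-i)) on. Over all nodes this is at most
    k + k' + max(k, k'), which equals [T] when the lengths are the prescribed ones. *)
Lemma timer_fires t i : a <= T -> b <= T -> i < n ->
  efire (timer_state t i) =
  (t == T) && ((k == a) && (k' == b) || (k == b) && (k' == a)).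
Proof.
move=> aT bT il; rewrite /timer_state.
(* Saturation happens at T + 1 only, so a value up to [T] is never confused with another one; this
   applies to [a], [b] and [T] itself. *)
have satI c d : d <= T -> (sat c == sat d) = (c == d).
  move=> dT; apply/eqP/eqP => [/(congr1 val)|->] //=; rewrite !val_sat; lia.
have set2E : ([set sat k; sat k'] == [set sat a; sat b]) =
    ((k == a) && (k' == b) || (k == b) && (k' == a)).
  apply/eqP/orP => [E|[/andP[/eqP-> /eqP->]|/andP[/eqP-> /eqP->]] //]; last by rewrite setUC.
  have : sat a \in [set sat k; sat k'] by rewrite E !inE eqxx.
  have : sat b \in [set sat k; sat k'] by rewrite E !inE eqxx orbT.
  have : sat k \in [set sat a; sat b] by rewrite -E !inE eqxx.
  have : sat k' \in [set sat a; sat b] by rewrite -E !inE eqxx orbT.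
  rewrite !inE !(eq_sym (sat a)) !(eq_sym (sat b)) !satI //; lia.
have unionE : (forall e, isSome (arm_info t i e)) ->
    end_info i :|: \bigcup_e odflt set0 (arm_info t i e) = [set sat k; sat k'].
  move=> known; apply/eqP; rewrite eqEsubset; apply/andP; split.
    rewrite subUset; apply/andP; split.
      by rewrite subUset /end_info; do 2!case: ifP => _; rewrite ?sub0set ?sub1set ?inE ?eqxx ?orbT.
    apply/bigcupsP => e _; rewrite ffunE; case: (nbr l i e) => [j|]; last by rewrite sub0set.
    by do !case: ifP => _; rewrite /= ?sub0set ?sub1set ?inE ?eqxx ?orbT.
  rewrite subUset !sub1set; apply/andP; split.
    have [i0|i0] := posnP i; first by rewrite /end_info i0 !inE eqxx.
    have [e Ee] : exists e, nbr l i e = Some i.-1.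
      by have := @nbr_prev _ _ cl i.-1; rewrite prednK //; apply.
    rewrite inE; apply/orP; right; apply/bigcupP; exists e => //.
    have := known e; rewrite ffunE Ee prednK // leqnn; case: ifP => //= _ _.
    by rewrite inE.
  have [i1|i1] := eqVneq i n.-1; first by rewrite /end_info i1 eqxx !inE eqxx !orbT.
  have il1 : i.+1 < n by lia.
  have [e Ee] := nbr_next cl il1.
  rewrite inE; apply/orP; right; apply/bigcupP; exists e => //.
  have := known e; rewrite ffunE Ee ltnNge leqnSn /=; case: ifP => //= _ _.
  by rewrite inE.
have [tT|tT] := eqVneq t T; last first.
  by case: ifP => // _; rewrite /efire satI // (negbTE tT).
subst t; apply/idP/idP => [|/= M].
  by case: ifP => // _ /and3P[_ /forallP known]; rewrite unionE // set2E.
have known e : isSome (arm_info T i e).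
  rewrite ffunE; case: (nbr l i e) => [j|] //.
  have -> : k + i <= T by rewrite /T; lia.
  have -> : k' + (n.-1 - i) <= T by rewrite /T; lia.
  by case: ifP.
have -> : (T < i - k + (k - i)) = false by rewrite /T; lia.
by rewrite /efire eqxx unionE // set2E M andbT; apply/forallP.

Qed.

End Run.
End Exact.

(** * The minimum firing time *)

Section Product.
Variables A B : automaton.

Definition prod_delta (s : state A * state B) (nb : {ffun 'I_4 -> option (state A * state B)}) :
    state A * state B :=
  (delta s.1 [ffun e => omap fst (nb e)], delta s.2 [ffun e => omap snd (nb e)]).

Lemma prod_quiet_not_firing : ~~ (firing (qstate A) || firing (qstate B)).
Proof. by rewrite negb_or !qstate_not_firing. Qed.

Lemma prod_quiet_stable (nb : {ffun 'I_4 -> option (state A * state B)}) :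
  (forall e, nb e = None \/ nb e = Some (qstate A, qstate B)) ->
  prod_delta (qstate A, qstate B) nb = (qstate A, qstate B).
Proof.
move=> H; rewrite /prod_delta !qstate_stable // => e; rewrite ffunE.
  by case: (H e) => ->; [left | right].
by case: (H e) => ->; [left | right].
Qed.

Definition prod_automaton : automaton :=
  @Automaton (state A * state B)%type (qstate A, qstate B) #|{ffun 'I_4 -> bool}|
    (fun i => (gen (tau A (enum_val i)), gen (tau B (enum_val i))))
    (fun s => firing s.1 || firing s.2)
    enum_rank prod_delta prod_quiet_not_firing prod_quiet_stable.

Lemma run_prod l t p : run prod_automaton l t p = (run A l t p, run B l t p).
Proof.
elim: t p => [|t IH] p /=; first by case: eqP => // _; rewrite enum_rankK.
rewrite IH /prod_delta /=; congr pair; congr delta; apply/ffunP => e; rewrite !ffunE;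
  by case: ifP => //= _; rewrite IH.
Qed.

End Product.

Lemma exact_timer_firing a b l k t p : is_config l k -> p \in l ->
  firing (run (exact_timer a b) l t p) = (t == a + b + maxn a b) &&
    ((k == a) && ((size l).-1 - k == b) || (k == b) && ((size l).-1 - k == a)).
Proof.
move=> cl /(nthP origin)[i il <-].
rewrite /= (timer_run a b cl) //; apply: timer_fires => //; lia.
Qed.

(** The firing condition of the timer is the same at all nodes, so the product fires simultaneously
    at the first of the two times; where the lengths differ from the prescribed ones the timer stays
    silent and [A] alone decides. *)
Lemma prod_timer_fires A a b l k t : is_config l k -> fires_at A l t ->
  fires_at (prod_automaton A (exact_timer a b)) l
    (if (k == a) && ((size l).-1 - k == b) || (k == b) && ((size l).-1 - k == a)
     then minn t (a + b + maxn a b) else t).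
Proof.
move=> cl [nF F]; set M := _ || _.
have prodF t' p : p \in l -> firing (run (prod_automaton A (exact_timer a b)) l t' p) =
    firing (run A l t' p) || (t' == a + b + maxn a b) && M.
  by move=> lp; rewrite run_prod /= -(exact_timer_firing _ _ _ cl lp).
split=> [t' t't p lp|p lp]; rewrite prodF //.
  have t't1 : t' < t by move: t't; case: ifP => // _; rewrite leq_min => /andP[].
  rewrite negb_or nF //=; apply/andP => -[/eqP tE MT].
  by move: t't; rewrite MT leq_min tE ltnn andbF.
case: ifP => MT; last by rewrite F.
have [tT|Tt] := leqP t (a + b + maxn a b); first by rewrite F.
by rewrite eqxx orbT.
Qed.

(* C = p_r ... p_s is (l, k) with k = -r and s = size l - 1 - k;
   -r + s + max(-r, s) = k + s + maxn k s. *)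
Theorem theorem9 (l : seq pos) (k : nat) :
  is_config l k -> type_I l k ->
  let s := (size l - 1 - k)%N in
  is_mft l (k + s + maxn k s)%N.
Proof.
move=> cl tI s; split; last by move=> A sA t fA; apply: type_I_lower_bound sA fA.
exists (prod_automaton slow (exact_timer k s)); split.
  move=> l' k' cl'; have [t fA] := slow_solution cl'.
  by eexists; apply: prod_timer_fires cl' fA.
have [t fA] := slow_solution cl.
have := prod_timer_fires k s cl fA.
rewrite eqxx -subn1 eqxx /=.
by rewrite (minn_idPr (type_I_lower_bound cl tI slow_solution fA)).
Qed.
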